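(* For $i=1,2$, let $X_i\subset\mathbb{R}^d$ be convex and compact and let $\mu_i\in\mathcal{P}(X_i)$ have bounded Lebesgue density. Let $c\in C^2(X)$, $X=X_1\times X_2$, be nondegenerate. (i) Let $f(x)=x\log(x)$. Then $$\mathsf{OT}_{f,\varepsilon}-\mathsf{OT}\ge\frac d2\,\varepsilon\log(1/\varepsilon)+O(\varepsilon).$$ In particular, the leading term matches that of the upper bound $\frac{1}{2\alpha}\varepsilon\log(\frac1\varepsilon)+O(\varepsilon)$ (with $\alpha=1/d$) described in the context. (ii) Let $f(x)=\frac1\rho(x^\rho-1)$ for some $\rho>1$. Then $$\mathsf{OT}_{f,\varepsilon}-\mathsf{OT}\ge K\varepsilon^{\frac{1}{(\rho-1)d/2+1}}+O(\varepsilon)$$ for a constant $K>0$. In particular, the leading term has the same exponent as the upper bound $K'\varepsilon^{\frac{1}{(\rho-1)\beta+1}}$ (with $\beta=\frac{1}{2\alpha}=d/2$) described in the context.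
   Context: $\mathcal{P}(Y)$ denotes the Borel probability measures on $Y$ and $\Pi(\mu_1,\mu_2)$ the set of couplings of $\mu_1$ and $\mu_2$. $c\in C^2(X)$ means that $c$ is defined and twice continuously differentiable on a neighborhood of $X$. $c$ is nondegenerate if the $d\times d$ matrix $D^2_{xy}c(x,y)=[\partial^2_{x_iy_j}c(x,y)]_{1\le i,j\le d}$ is invertible for all $(x,y)\in X$. $D_f(\mu,\nu)=\int f(\frac{d\mu}{d\nu})\,d\nu$ if $\mu\ll\nu$ and $D_f(\mu,\nu)=\infty$ otherwise (with $0\log0=0$). For $\varepsilon>0$, $$\mathsf{OT}=\inf_{\pi\in\Pi(\mu_1,\mu_2)}\int c\,d\pi,\qquad \mathsf{OT}_{f,\varepsilon}=\inf_{\pi\in\Pi(\mu_1,\mu_2)}\int c\,d\pi+\varepsilon D_f(\pi,\mu_1\otimes\mu_2).$$ The terms $O(\varepsilon)$ are understood as $\varepsilon\to0$. The upper bounds used for comparison are those the paper obtains for two marginals and $C^2$ costs with bounded second derivative, when some minimizer $\pi^*$ of $\mathsf{OT}$ has 2-Wasserstein quantization rate $\alpha\in(0,1]$, i.e., there is a constant $C>0$ such that for every $n\ge1$ some probability measure $\pi^n$ supported on at most $n$ points satisfies $W_2(\pi^n,\pi^* )\le Cn^{-\alpha}$, where $W_2$ is the 2-Wasserstein distance for the Euclidean metric. They read: $\mathsf{OT}_{f,\varepsilon}-\mathsf{OT}\le\frac{1}{2\alpha}\varepsilon\log(\frac1\varepsilon)+O(\varepsilon)$ for $f(x)=x\log(x)$,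 and $\mathsf{OT}_{f,\varepsilon}-\mathsf{OT}\le K'\varepsilon^{\frac{1}{(\rho-1)\beta+1}}$ with $\beta=\frac1{2\alpha}$ and a constant $K'$ for $f(x)=\frac1\rho(x^\rho-1)$. For nondegenerate costs and compactly supported marginals, the paper shows that any optimal transport has rate $\alpha=1/d$. *)

(* Defs.v *)
From HB Require Import structures.
From mathcomp Require Import all_boot all_order all_algebra.
From mathcomp Require Import all_classical all_reals all_analysis.
From mathcomp Require Import measurable_realfun.

Set Implicit Arguments.
Unset Strict Implicit.
Unset Printing Implicit Defensive.

Import Order.TTheory GRing.Theory Num.Theory.
Import numFieldNormedType.Exports.

Local Open Scope classical_set_scope.
Local Open Scope ring_scope.

Section borel_rV.
Context {R : realType} {n : nat}.

Definition rV_display : measure_display.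
Proof. exact: default_measure_display. Qed.

Definition borel_rV : set (set 'rV[R]_n) := <<s @open 'rV[R]_n >>.

Let borel_rV0 : borel_rV set0.
Proof. exact: sigma_algebra0. Qed.

Let borel_rVC A : borel_rV A -> borel_rV (~` A).
Proof. exact: sigma_algebraC. Qed.

Let borel_rV_bigcup (F : (set 'rV[R]_n)^nat) :
  (forall i, borel_rV (F i)) -> borel_rV (\bigcup_i F i).
Proof. exact: sigma_algebra_bigcup. Qed.

HB.instance Definition _ := @isMeasurable.Build rV_display
  'rV[R]_n borel_rV borel_rV0 borel_rVC borel_rV_bigcup.
End borel_rV.

Section measurable_rV.
Context {R : realType}.

Lemma open_measurable_rV n (A : set 'rV[R]_n) : open A -> measurable A.
Proof. by move=> oA; exact: sub_sigma_algebra. Qed.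

Lemma continuous_measurable_rV n (f : 'rV[R]_n -> R) :
  continuous f -> measurable_fun [set: 'rV[R]_n] f.
Proof.
move=> cf; apply: (measurability (@RGenOInfty.G R)).
  exact: RGenOInfty.measurableE.
move=> _ [_ [a ->] <-]; rewrite setTI; apply: open_measurable_rV.
by apply: open_comp => //; exact: interval_open.
Qed.

Let box n (q : 'rV[rat]_n * rat) : set 'rV[R]_n :=
  [set v | forall i, `| ratr (q.1 ord0 i) - v ord0 i | < ratr q.2].

Let open_bigcup_box n (A : set 'rV[R]_n) : open A ->
  A = \bigcup_(q in [set q | box q `<=` A]) box q.
Proof.
move=> oA; apply/seteqP; split => [v Av|v [q qA]]; last exact: qA.
have /nbhs_ballP[e /= e0 veA] : nbhs v A by exact: open_nbhs_nbhs.
have [r /[!in_itv]/= /andP[r0 re]] := rat_in_itvoo (divr_gt0 e0 (@ltr0n R 2)).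
have /choice[q qv] : forall i, exists q : rat, `|ratr q - v ord0 i| < ratr r.
  move=> i; have [|q /[!in_itv]/= qv] :=
    @rat_in_itvoo R (v ord0 i - ratr r) (v ord0 i + ratr r).
    by rewrite ltrBlDr -addrA ltrDl addr_gt0.
  by exists q; rewrite ltr_distl.
exists (\row_i q i, r) => [w /= wq|i]; last by rewrite !mxE.
apply: veA; split => // i j; rewrite (ord1 i) -ball_normE /=.
rewrite (@le_lt_trans _ _ (`|ratr (q j) - v ord0 j| + `|ratr (q j) - w ord0 j|))//.
  by rewrite (distrC (ratr (q j)) (v _ _)) (le_trans _ (ler_normD _ _))// addrA subrK.
have := wq j; rewrite !mxE /= => wj.
by rewrite [e]splitr ltrD// (lt_trans _ re).
Qed.

Lemma measurable_fun_rV d (T : measurableType d) n (f : T -> 'rV[R]_n) :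
  (forall i, measurable_fun [set: T] (fun t => f t ord0 i)) ->
  measurable_fun [set: T] f.
Proof.
move=> mf; apply: (measurability (@open 'rV[R]_n)) => //.
move=> _ [A oA <-]; rewrite setTI (open_bigcup_box oA) preimage_bigcup.
rewrite bigcup_mkcond; apply: countable_bigcupT_measurable => [|q]; first exact: countableP.
case: ifPn => // _.
rewrite (_ : _ @^-1` _ = \bigcap_(i in [set: 'I_n])
    ((fun t => f t ord0 i) @^-1` ball (ratr (q.1 ord0 i) : R) (ratr q.2))).
  apply: fin_bigcap_measurable => // i _; rewrite -[X in measurable X]setTI.
  by apply: mf => //; apply: open_measurable; exact: ball_open.
apply/seteqP; split=> t /= tq i; first by move=> _; rewrite -ball_normE; exact: tq.
by have := tq i I; rewrite -ball_normE.
Qed.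

End measurable_rV.

Section lebesgue_rV.
Context {R : realType}.

Definition rV_cons n (xv : measurableTypeR R * 'rV[R]_n) : 'rV[R]_n.+1 :=
  row_mx (const_mx xv.1 : 'rV[R]_1) xv.2.

Definition rV_uncons n (v : 'rV[R]_n.+1) : measurableTypeR R * 'rV[R]_n :=
  (v ord0 ord0, rsubmx (v : 'rV[R]_(1 + n))).

Lemma rV_consK n : cancel (@rV_cons n) (@rV_uncons n).
Proof.
move=> [x v]; rewrite /rV_uncons /rV_cons /= row_mxKr; congr pair.
transitivity ((row_mx (const_mx x : 'rV[R]_1) v) ord0 (lshift n ord0)).
  by congr (row_mx _ _ _ _); exact/val_inj.
by rewrite row_mxEl mxE.
Qed.

Lemma measurable_rV_cons n : measurable_fun [set: _] (@rV_cons n).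
Proof.
apply: measurable_fun_rV => i.
have [/= j ij|/= j ij] := @fintype.splitP 1 n i.
  rewrite (_ : (fun _ => _) = fst); first exact: measurable_fst.
  apply/funext => -[x v] /=; rewrite /rV_cons (_ : i = lshift n j); last exact/val_inj.
  by rewrite (@row_mxEl _ 1 1 n) mxE.
rewrite (_ : (fun _ => _) = (fun v : 'rV[R]_n => v ord0 j) \o snd).
  apply: measurableT_comp; last exact: measurable_snd.
  apply: (continuous_measurable_rV (f := fun v : 'rV[R]_n => v ord0 j)).
  exact: coord_continuous.
apply/funext => -[x v] /=; rewrite /rV_cons (_ : i = rshift 1 j); last exact/val_inj.
by rewrite (@row_mxEr _ 1 1 n).
Qed.

Lemma measurable_rV_uncons n : measurable_fun [set: _] (@rV_uncons n).
Proof.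
have mcoord i : measurable_fun setT (fun v : 'rV[R]_n.+1 => v ord0 i).
  exact: (continuous_measurable_rV (@coord_continuous R 1 n.+1 ord0 i)).
apply: measurable_fun_pair; first by move=> _ Y mY; exact: mcoord.
apply: measurable_fun_rV => i.
rewrite (_ : (fun _ => _) = fun v : 'rV[R]_n.+1 => v ord0 (rshift 1 i)).
  exact: mcoord.
by apply/funext => v; rewrite mxE.
Qed.

Section step.
Local Open Scope ereal_scope.
Variables (n : nat) (L : {sigma_finite_measure set 'rV[R]_n -> \bar R}).

Definition lebesgue_rV_step : set 'rV[R]_n.+1 -> \bar R :=
  pushforward (lebesgue_measure \x L) (@rV_cons n).

Let step0 : lebesgue_rV_step set0 = 0.
Proof. by rewrite /lebesgue_rV_step /pushforward preimage_set0 measure0. Qed.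

Let step_ge0 A : 0 <= lebesgue_rV_step A.
Proof. exact: (measure_ge0 (lebesgue_measure \x L)). Qed.

Let step_sigma_additive : semi_sigma_additive lebesgue_rV_step.
Proof.
have mpre (A : set 'rV[R]_n.+1) : measurable A -> measurable (@rV_cons n @^-1` A).
  by move=> mA; rewrite -[X in measurable X]setTI; exact: measurable_rV_cons.
move=> F mF tF mUF; rewrite /lebesgue_rV_step /pushforward preimage_bigcup.
apply: (@measure_semi_sigma_additive _ _ _ (lebesgue_measure \x L)) => [k||].
- exact: mpre.
- apply/trivIsetP => i j _ _ ij; rewrite -preimage_setI.
  by move/trivIsetP : tF => /(_ _ _ _ _ ij) ->//; rewrite preimage_set0.
- by rewrite -preimage_bigcup; exact: mpre.
Qed.

HB.instance Definition _ := isMeasure.Build _ _ _ lebesgue_rV_step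
  step0 step_ge0 step_sigma_additive.

Let step_sigma_finite : sigma_finite setT lebesgue_rV_step.
Proof.
have /sigma_finiteP[F [TF ndF Foo]] := sigma_finiteT (@lebesgue_measure R).
have /sigma_finiteP[G [TG ndG Goo]] := sigma_finiteT L.
pose FG k : set (measurableTypeR R * 'rV[R]_n) := F k `*` G k.
exists (fun k => @rV_uncons n @^-1` FG k).
  rewrite -preimage_bigcup (_ : \bigcup_i FG i = setT) ?preimage_setT//.
  apply/seteqP; split=> // -[x v] _.
  have [i _ Fix] : (\bigcup_i F i) x by rewrite -TF.
  have [j _ Gjv] : (\bigcup_i G i) v by rewrite -TG.
  exists (maxn i j) => //; split => /=.
  - by move: x Fix; exact/subsetPset/ndF/leq_maxl.
  - by move: v Gjv; exact/subsetPset/ndG/leq_maxr.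
move=> k; have [mF Fk] := Foo k; have [mG Gk] := Goo k.
have mFG : measurable (FG k) by exact: measurableX.
split; first by rewrite -[X in measurable X]setTI; exact: measurable_rV_uncons.
rewrite /lebesgue_rV_step /pushforward -comp_preimage.
rewrite (_ : _ \o _ = id); last by apply/funext => x; exact: rV_consK.
by rewrite preimage_id product_measure1E// lte_mul_pinfty// ge0_fin_numE.
Qed.

HB.instance Definition _ := Measure_isSigmaFinite.Build _ _ _ lebesgue_rV_step
  step_sigma_finite.
End step.

Fixpoint lebesgue_rV n : {sigma_finite_measure set 'rV[R]_n -> \bar R} :=
  if n is n'.+1 then lebesgue_rV_step (lebesgue_rV n')
  else \d_(0 : 'rV[R]_0).

End lebesgue_rV.

Lemma lebesgue_rV_box (R : realType) n (A : 'I_n -> set (measurableTypeR R)) :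
  (forall i, measurable (A i)) ->
  lebesgue_rV n [set v : 'rV[R]_n | forall i, A i (v ord0 i)] =
  (\prod_(i < n) lebesgue_measure (A i))%E.
Proof.
elim: n A => [|n IH] A mA.
  rewrite big_ord0 /= diracE mem_set// => i; by case: i.
rewrite big_ord_recl /= /lebesgue_rV_step /pushforward.
rewrite (_ : _ @^-1` _ = A ord0 `*` [set v : 'rV[R]_n | forall i, A (lift ord0 i) (v ord0 i)]); last first.
  have E0 x (v : 'rV[R]_n) : rV_cons (x, v) ord0 ord0 = x.
    by have /(congr1 fst) := rV_consK (x, v).
  have ES x (v : 'rV[R]_n) i : rV_cons (x, v) ord0 (lift ord0 i) = v ord0 i.
    rewrite /rV_cons (_ : lift ord0 i = rshift 1 i); last exact/val_inj.
    by rewrite (@row_mxEr _ 1 1 n).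
  apply/seteqP; split => -[x v] /=.
    by move=> xvA; split => [|i]; [rewrite -(E0 x v)|rewrite -(ES x v)].
  move=> [xA vA] i; case: (unliftP ord0 i) => [j ->|->]; first by rewrite ES.
  by rewrite E0.
rewrite product_measure1E//; first by rewrite (IH (fun i => A (lift ord0 i))).
rewrite (_ : [set v : 'rV[R]_n | _] = \bigcap_(i in [set: 'I_n])
  ((fun v : 'rV[R]_n => v ord0 i) @^-1` A (lift ord0 i))).
  apply: fin_bigcap_measurable => // i _; rewrite -[X in measurable X]setTI.
  exact: (continuous_measurable_rV (@coord_continuous R 1 n ord0 i) measurableT (mA _)).
by apply/seteqP; split=> v /= vA i; [move=> _|]; exact: vA.
Qed.

Section transport.
Context {R : realType} {d : measure_display} {T : measurableType d}.
Local Open Scope ereal_scope.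

(* 'd mu '/d nu is only defined up to a nu-null set and is real-valued when
   mu `<< nu, so [fine] loses nothing. *)
Definition f_divergence (f : R -> R) (mu nu : probability T R) : \bar R :=
  if `[< mu `<< nu >] then
    \int[nu]_x (f (fine (Radon_Nikodym (charge_of_finite_measure mu) nu x)))%:E
  else +oo.
End transport.

Section optimal_transport.
Context {R : realType} {d1 d2 : measure_display}.
Context {T1 : measurableType d1} {T2 : measurableType d2}.
Local Open Scope ereal_scope.
Implicit Types (X : set (T1 * T2)) (c : T1 * T2 -> R).

Definition couplings (mu1 : probability T1 R)
    (mu2 : probability T2 R) : set (probability (T1 * T2)%type R) :=
  [set pi | (forall A, measurable A -> pi (fst @^-1` A) = mu1 A) /\
            (forall B, measurable B -> pi (snd @^-1` B) = mu2 B)].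

(* c may be given only near X, hence the integral over X; nothing is lost when X
   is a product of two sets carrying mu1 and mu2. *)
Definition OT X c (mu1 : probability T1 R)
    (mu2 : probability T2 R) : \bar R :=
  ereal_inf [set \int[pi]_(z in X) (c z)%:E | pi in couplings mu1 mu2].

Definition OT_div (f : R -> R) (eps : R) X c (mu1 : probability T1 R)
    (mu2 : probability T2 R) : \bar R :=
  ereal_inf [set \int[pi]_(z in X) (c z)%:E
                 + eps%:E * f_divergence f pi (mu1 \x mu2)
            | pi in couplings mu1 mu2].
End optimal_transport.

Section statement.
Context {R : realType}.

(* ln 0 = 0, so xlnx 0 = 0. *)
Definition xlnx (x : R) : R := x * ln x.

Definition power_div (rho x : R) : R := rho^-1 * (x `^ rho - 1).

(* In finite dimension, f is C^1 on an open set iff its directional derivatives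
   exist and are continuous there. *)
Definition C1_on (V : normedModType R) (U : set V) (f : V -> R) :=
  forall v z, U z -> derivable f z v /\ {for z, continuous ('D_v f)}.

Definition C2_on (V : normedModType R) (U : set V) (f : V -> R) :=
  C1_on U f /\ forall v, C1_on U ('D_v f).

Definition C2_near (V : normedModType R) (X : set V) (f : V -> R) :=
  exists U : set V, [/\ open U, X `<=` U & C2_on U f].

Definition mixed_hessian d (c : 'rV[R]_d * 'rV[R]_d -> R)
    (z : 'rV[R]_d * 'rV[R]_d) : 'M[R]_d :=
  \matrix_(i, j) 'D_((delta_mx ord0 i : 'rV[R]_d), (0 : 'rV[R]_d))
                   ('D_((0 : 'rV[R]_d), (delta_mx ord0 j : 'rV[R]_d)) c) z.

Definition nondegenerate_cost d (X : set ('rV[R]_d * 'rV[R]_d))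
    (c : 'rV[R]_d * 'rV[R]_d -> R) :=
  forall z, X z -> mixed_hessian c z \in unitmx.

Definition bounded_density d (mu : probability 'rV[R]_d R) :=
  exists g : 'rV[R]_d -> R,
    [/\ measurable_fun [set: 'rV[R]_d] g,
        forall x, 0 <= g x,
        exists M, forall x, g x <= M &
        forall A, measurable A ->
          mu A = (\int[lebesgue_rV d]_(x in A) (g x)%:E)%E].

(* F eps >= L eps + O(eps) as eps -> 0+; in a lower bound only the lower half of
   the O(eps) matters. *)
Definition ge_upto_bigO (F : R -> \bar R) (L : R -> R) :=
  exists C : R, \forall eps \near 0^'+, ((L eps - C * eps)%:E <= F eps)%E.

(* The leading term and exponent of the known upper bounds when some optimal
   transport has 2-Wasserstein quantization rate alpha. *)
Definition entropic_upper_term (alpha eps : R) : R :=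
  (2 * alpha)^-1 * eps * ln (eps^-1).

Definition power_upper_exponent (rho alpha : R) : R :=
  let beta := (2 * alpha)^-1 in ((rho - 1) * beta + 1)^-1.

End statement.

(* Main.v *)
(* Cut X1 and X2 into finitely many cells on which c oscillates by O(eps). Finite
   Kantorovich duality gives potentials u, v with E = c - u - v >= 0 on cells and
   dual value OT up to O(eps); no continuous duality is used. Young's inequality
   f(x) >= x y - G(y), G the conjugate of f, with y = (lam - E / eps)_+ and x the
   density of a coupling pi with respect to P = mu1 x mu2, gives
     \int c dpi + eps D_f(pi, P) >= OT + eps (lam - \int G(y) dP) - O(eps).
   The key estimate is P(E <= delta) <= C delta^(d/2): if E <= delta at (x, y) and
   (x', y'), then c(x, y) + c(x', y') - c(x, y') - c(x', y) <= 2 delta, while this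
   difference is close to <(x - x') A, y - y'> with A = D^2_xy c invertible. In the
   coordinates p = x A + y and q = x A - y this reads |dp|^2 <= O(delta) + 3 |dq|^2,
   so {E <= delta} is locally covered by O(delta^(-d/2)) boxes of side
   O(delta^(1/2)) in R^(2d), each of P-mass O(delta^d) by the bounded densities.
   Choosing lam = (d/2) log(1/eps), resp. lam = a eps^(1/((rho-1)d/2+1) - 1) with a
   small, gives the two rates. *)
Require Import Defs.
From HB Require Import structures.
From mathcomp Require Import all_boot all_order all_algebra.
From mathcomp Require Import all_classical all_reals all_analysis.
From mathcomp Require Import measurable_realfun.
From mathcomp Require Import ring lra.

Set Implicit Arguments.
Unset Strict Implicit.
Unset Printing Implicit Defensive.

Import Order.TTheory GRing.Theory Num.Theory.
Import numFieldNormedType.Exports.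

Local Open Scope classical_set_scope.
Local Open Scope ring_scope.

(** * Finite Kantorovich duality *)

Section finite_duality.
Context {R : realType} {n m : nat}.
Implicit Types (a : 'I_n -> R) (b : 'I_m -> R) (p : 'M[R]_(n, m)).

(** The number of cells grows without control as [eps] tends to 0, so no estimate may depend on the
    partition. The mass bound is therefore proved for every measurable subset of [X] on which the
    cross differences of [c] are small. Nonnegativity of E on the crossed cells of (x, y') and (x',
    y) puts the sets where E is at most [t * eps] among these. The discretization error is itself of
    order [eps], which is why the bound is claimed only for [t >= 1]. To compare the finite problem
    with [OT], a discrete plan is spread over the cells and becomes a genuine coupling of [mu1] and
    [mu2]. The scale of lam comes from balancing the term in G against lam. For G(t) = exp(t - 1)
    the balance is exp(lam) eps^(d/2) = 1. For G of order t^(r+1) with r = 1/(rho-1), only the set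
    where E / eps is at most lam matters, and the balance asks lam^r (lam eps)^(d/2) to be a small
    constant; then eps lam is a multiple of eps^(1/((rho-1)d/2+1)). *)

Definition plan_cost (c : 'I_n -> 'I_m -> R) p := \sum_i \sum_j c i j * p i j.

Definition marginal_gap a b p :=
  \sum_i (\sum_j p i j - a i) ^+ 2 + \sum_j (\sum_i p i j - b j) ^+ 2.

Lemma compact_box (B : R) :
  compact [set q : 'rV[R]_(n * m) | forall k, 0 <= q ord0 k <= B].
Proof.
have := @rV_compact R (n * m) (fun=> `[0, B]%classic) (fun=> @segment_compact R 0 B).
by congr compact; apply/seteqP; split => q /= + k => /(_ k); rewrite in_itv.
Qed.

Lemma continuous_entry i j : continuous (fun q : 'rV[R]_(n * m) => vec_mx q i j).
Proof.
rewrite (_ : (fun _ => _) = fun q : 'rV[R]_(n * m) => q ord0 (mxvec_index i j)).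
  exact: coord_continuous.
by apply/funext => q; rewrite mxE.
Qed.

Lemma continuous_sumr (T : topologicalType) (I : finType) (F : I -> T -> R) :
  (forall i, continuous (F i)) -> continuous (fun x => \sum_i F i x).
Proof. by move=> cF; apply: continuous_big => //; exact: add_continuous. Qed.

Lemma continuous_plan_cost c : continuous (fun q => plan_cost c (vec_mx q)).
Proof.
apply: (@continuous_sumr 'rV[R]_(n * m) 'I_n (fun i q => \sum_j c i j * vec_mx q i j)) => i.
apply: (@continuous_sumr 'rV[R]_(n * m) 'I_m (fun j q => c i j * vec_mx q i j)) => j q.
by apply: continuousM; [exact: cst_continuous|exact: continuous_entry].
Qed.

Lemma continuous_marginal_gap a b : continuous (fun q => marginal_gap a b (vec_mx q)).
Proof.
have csqr (f : 'rV[R]_(n * m) -> R) (k : R) : continuous f ->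
    continuous (fun q => (f q - k) ^+ 2).
  move=> cf q; have cfk : {for q, continuous (fun q => f q - k)}.
    by apply: continuousB; [exact: cf|exact: cst_continuous].
  exact: (continuousM cfk cfk).
have crow i : continuous (fun q : 'rV[R]_(n * m) => (\sum_j vec_mx q i j - a i) ^+ 2).
  apply: (csqr (fun q => \sum_j vec_mx q i j)).
  by apply: (@continuous_sumr _ 'I_m (fun j q => vec_mx q i j)) => j; exact: continuous_entry.
have ccol j : continuous (fun q : 'rV[R]_(n * m) => (\sum_i vec_mx q i j - b j) ^+ 2).
  apply: (csqr (fun q => \sum_i vec_mx q i j)).
  by apply: (@continuous_sumr _ 'I_n (fun i q => vec_mx q i j)) => i; exact: continuous_entry.
have crows := @continuous_sumr _ 'I_n _ crow.
have ccols := @continuous_sumr _ 'I_m _ ccol.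
move=> q; exact: (continuousD (crows q) (ccols q)).
Qed.

Lemma sum_perturb_row p i j (t : R) k :
  \sum_l (p + t *: delta_mx i j) k l = \sum_l p k l + t * (k == i)%:R.
Proof.
under eq_bigr do rewrite !mxE.
rewrite big_split /= -mulr_sumr; congr (_ + _ * _).
case: eqP => _ /=; last by rewrite big1.
rewrite (bigD1 j)//= eqxx big1 ?addr0// => l /negbTE ->//.
Qed.

Lemma sum_perturb_col p i j (t : R) l :
  \sum_k (p + t *: delta_mx i j) k l = \sum_k p k l + t * (l == j)%:R.
Proof.
under eq_bigr do rewrite !mxE.
rewrite big_split /= -mulr_sumr; congr (_ + _ * _).
case: (l == j); last by rewrite big1// => k _; rewrite andbF.
rewrite (bigD1 i)//= eqxx big1 ?addr0// => k /negbTE ->//.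
Qed.

Lemma plan_cost_perturb c p i j (t : R) :
  plan_cost c (p + t *: delta_mx i j) = plan_cost c p + t * c i j.
Proof.
rewrite /plan_cost [in RHS](bigD1 i)//= (bigD1 i)//= [in RHS](bigD1 j)//= (bigD1 j)//=.
rewrite (eq_bigr (fun l => c i l * p i l))
  => [|l /negbTE lj]; last first.
  by rewrite !mxE lj andbF mulr0 addr0.
rewrite (eq_bigr (fun k => \sum_l c k l * p k l)) => [|k /negbTE ki]; last first.
  by apply: eq_bigr => l _; rewrite !mxE ki mulr0 addr0.
by rewrite !mxE !eqxx /=; ring.
Qed.

(** One entry lies in one row and in one column, so the squared increment appears twice. The linear
    coefficient is, up to sign and the factor [N], the future sum of multipliers [u i + w j]. *)
Lemma marginal_gap_perturb a b p i j (t : R) :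
  marginal_gap a b (p + t *: delta_mx i j) = marginal_gap a b p +
    2 * t * ((\sum_l p i l - a i) + (\sum_k p k j - b j)) + 2 * t ^+ 2.
Proof.
rewrite /marginal_gap [in RHS](bigD1 i)//= (bigD1 i)//=.
rewrite [X in _ = _ + X + _ + _](bigD1 j)//= [X in _ + X = _](bigD1 j)//=.
rewrite (eq_bigr (fun k => (\sum_j0 p k j0 - a k) ^+ 2)) => [|k /negbTE ki]; last first.
  by rewrite sum_perturb_row ki mulr0 addr0.
rewrite [X in _ + (_ + X) = _](eq_bigr (fun l => (\sum_k p k l - b l) ^+ 2))
  => [|l /negbTE lj]; last first.
  by rewrite sum_perturb_col lj mulr0 addr0.
by rewrite sum_perturb_row sum_perturb_col !eqxx /=; ring.
Qed.

Lemma marginal_gap_ge0 a b p : 0 <= marginal_gap a b p.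
Proof. by rewrite addr_ge0// sumr_ge0// => i _; rewrite sqr_ge0. Qed.

Lemma marginal_gap_eq0 a b p : marginal_gap a b p = 0 ->
  (forall i, \sum_j p i j = a i) /\ (forall j, \sum_i p i j = b j).
Proof.
move/eqP; rewrite paddr_eq0 ?sumr_ge0//; try by move=> i _; rewrite sqr_ge0.
rewrite !psumr_eq0; try by move=> i _; rewrite sqr_ge0.
by case/andP => /allP ha /allP hb; split => i;
  [have := ha i (mem_index_enum i)|have := hb i (mem_index_enum i)];
  rewrite /= sqrf_eq0 subr_eq0 => /eqP.
Qed.

(* Writing <p> for the marginals of p, a minimizer over the box [0, 3]^(n m) of
   cost + N/2 |<p> - (a, b)|^2 has the duals N (a - row sums), N (b - column sums)
   for its multipliers: stationarity is complementary slackness, and for N large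
   neither the constraint p <= 3 nor cost <= v can be met. *)
Lemma finite_kantorovich a b (c : 'I_n -> 'I_m -> R) (v : R) :
  (forall i, 0 <= a i) -> (forall j, 0 <= b j) ->
  \sum_i a i = 1 -> \sum_j b j = 1 ->
  (forall p, (forall i j, 0 <= p i j) -> (forall i, \sum_j p i j = a i) ->
     (forall j, \sum_i p i j = b j) -> v < plan_cost c p) ->
  exists u w, (forall i j, u i + w j <= c i j) /\
              v <= \sum_i u i * a i + \sum_j w j * b j.
Proof.
move=> a0 b0 a1 b1 vlt.
pose box := [set q : 'rV[R]_(n * m) | forall k, 0 <= q ord0 k <= 3].
have boxP q : box q -> forall i j, 0 <= vec_mx q i j <= 3.
  by move=> bq i j; rewrite mxE.
have box_mx p : (forall i j, 0 <= p i j <= 3) -> box (mxvec p).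
  by move=> p3 k; case/mxvec_indexP: k => i j; rewrite mxvecE.
pose C : R := \sum_i \sum_j `|c i j| * 3.
have costC q : box q -> `|plan_cost c (vec_mx q)| <= C.
  move=> /boxP bq; rewrite (le_trans (ler_norm_sum _ _ _))// ler_sum// => i _.
  rewrite (le_trans (ler_norm_sum _ _ _))// ler_sum// => j _.
  rewrite normrM ler_wpM2l//; have /andP[? ?] := bq i j; by rewrite ger0_norm.
have C0 : 0 <= C by rewrite sumr_ge0// => i _; rewrite sumr_ge0// => j _; rewrite mulr_ge0.
have a_le1 i : a i <= 1 by rewrite -a1 (bigD1 i)//= lerDl sumr_ge0.
have b_le1 j : b j <= 1 by rewrite -b1 (bigD1 j)//= lerDl sumr_ge0.
pose ab : 'M[R]_(n, m) := \matrix_(i, j) (a i * b j).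
have ab_box : box (mxvec ab).
  apply: box_mx => i j; rewrite mxE mulr_ge0//=.
  by apply: (@le_trans _ _ 1); [exact: mulr_ile1|lra].
have ab_gap : marginal_gap a b ab = 0.
  rewrite /marginal_gap !big1 ?addr0// => [j|i] _.
    under eq_bigr do rewrite mxE.
    by rewrite -mulr_suml a1 mul1r subrr expr0n.
  under eq_bigr do rewrite mxE.
  by rewrite -mulr_sumr b1 mulr1 subrr expr0n.
(* An exact plan costs more than [v], so the gap has no zero on this compact set and stays above
   some [kappa > 0]. The strict inequality in the hypothesis is used here. *)
pose low := box `&` [set q | plan_cost c (vec_mx q) <= v].
have [kappa kappa0 low_gap] : exists2 kappa : R, 0 < kappa &
    forall q, low q -> kappa <= marginal_gap a b (vec_mx q).
  have [low0|/set0P lowN] := eqVneq low set0.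
    by exists 1 => // q; rewrite low0.
  have clow : compact low.
    apply: compact_closedI; first exact: compact_box.
    exact: (closed_comp (fun q _ => @continuous_plan_cost c q) (@closed_le R v)).
  have [q + qmin] := compact_EVT_min lowN clow
    (continuous_subspaceT (@continuous_marginal_gap a b)).
  rewrite inE => -[bq /= qv]; exists (marginal_gap a b (vec_mx q)); last first.
    by move=> q' lq'; apply: qmin; rewrite inE.
  rewrite lt_neqAle marginal_gap_ge0 andbT eq_sym; apply/eqP => /marginal_gap_eq0[ra rb].
  have := vlt (vec_mx q) (fun i j => proj1 (andP (boxP _ bq i j))) ra rb.
  by rewrite ltNge qv.
(* [N > C] excludes an entry equal to 3: it forces a gap of at least 4, while the zero matrix has
   gap at most 2. [N * kappa > 4 * C] excludes a cost of at most [v], by comparison with the product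
   plan, whose gap is 0. *)
pose N : R := 1 + C + 4 * C / kappa + 1.
have NC : C < N.
  by rewrite /N; have : 0 <= 4 * C / kappa; [rewrite !mulr_ge0// invr_ge0 ltW|lra].
have N0 : 0 < N by exact: le_lt_trans C0 NC.
have Nk : 4 * C < N * kappa.
  rewrite -ltr_pdivrMr// /N; lra.
pose Phi q := plan_cost c (vec_mx q) + N / 2 * marginal_gap a b (vec_mx q).
have cPhi : continuous Phi.
  have cgap : continuous (fun q : 'rV[R]_(n * m) => N / 2 * marginal_gap a b (vec_mx q)).
    move=> q'; have cN : {for q', continuous (fun=> N / 2)} by exact: cst_continuous.
    exact: (continuousM cN (@continuous_marginal_gap a b q')).
  by move=> q; exact: (continuousD (@continuous_plan_cost c q) (cgap q)).
have [q + qmin] := compact_EVT_min (ex_intro _ _ ab_box) (@compact_box 3)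
  (continuous_subspaceT cPhi).
rewrite inE => bq; have [p Ep] : {p | p = vec_mx q} by exists (vec_mx q).
have PhiE q' : box q' -> Phi q <= Phi q' by move=> bq'; apply: qmin; rewrite inE.
have p0 i j : 0 <= p i j by rewrite Ep; case/andP: (boxP _ bq i j).
have p3 i j : p i j < 3.
  rewrite ltNge; apply/negP => pij.
  have b0x : box (mxvec (0 : 'M[R]_(n, m))).
    by apply: box_mx => k l; rewrite mxE lexx/=.
  have := PhiE _ b0x; rewrite /Phi mxvecK.
  have -> : plan_cost c 0 = 0.
    by rewrite /plan_cost big1// => k _; rewrite big1// => l _; rewrite mxE mulr0.
  have : marginal_gap a b 0 <= 2.
    rewrite /marginal_gap -[2]/(1 + 1) -{1}a1 -b1 lerD// ler_sum// => k _;
      rewrite big1 ?sub0r ?sqrrN => [|l _]; rewrite ?mxE//.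
      by rewrite expr2 ler_piMr.
    by rewrite expr2 ler_piMr.
  have : 4 <= marginal_gap a b p.
    rewrite /marginal_gap (bigD1 i)//= -addrA.
    apply: (@le_trans _ _ ((\sum_l p i l - a i) ^+ 2)).
      have : 2 <= \sum_l p i l - a i.
        rewrite (bigD1 j)//=; have := a_le1 i.
        have : 0 <= \sum_(l < m | l != j) p i l by exact: sumr_ge0.
        lra.
      by move: (_ - _) => x x2; rewrite expr2; nra.
    by rewrite lerDl addr_ge0// sumr_ge0// => k _; exact: sqr_ge0.
  have := costC _ bq; rewrite ler_norml -Ep => /andP[+ _].
  set g := marginal_gap _ _ p; set g0 := marginal_gap _ _ 0.
  set k := plan_cost c p => h1 h2 h3.
  have : N * 4 <= N * g by rewrite ler_pM2l.
  have : N * g0 <= N * 2 by rewrite ler_pM2l.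
  have -> : N / 2 * g = N * g / 2 by ring.
  have -> : N / 2 * g0 = N * g0 / 2 by ring.
  lra.
have pv : v < plan_cost c p.
  rewrite ltNge; apply/negP => pv.
  have kg : kappa <= marginal_gap a b p by rewrite Ep; apply: low_gap; rewrite /low /= -Ep.
  have := PhiE _ ab_box; rewrite /Phi mxvecK ab_gap mulr0 addr0 -Ep => h.
  have := costC _ bq; have := costC _ ab_box.
  rewrite mxvecK !ler_norml -Ep => /andP[_ h1] /andP[h2 _].
  have : N * kappa <= N * marginal_gap a b p by rewrite ler_pM2l.
  have : N / 2 * marginal_gap a b p = N * marginal_gap a b p / 2 by ring.
  lra.
pose ra i := \sum_j p i j; pose cb j := \sum_i p i j.
pose u i := N * (a i - ra i); pose w j := N * (b j - cb j).
have slope i j t : 0 <= p i j + t <= 3 -> 0 <= t * (c i j - u i - w j + N * t).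
  move=> pt.
  have bp : box (mxvec (p + t *: delta_mx i j)).
    apply: box_mx => k l; rewrite !mxE.
    case: (altP (k =P i)) => [->|_] /=; last by rewrite mulr0 addr0 p0 ltW.
    case: (altP (l =P j)) => [->|_] /=; last by rewrite mulr0 addr0 p0 ltW.
    by rewrite mulr1.
  have := PhiE _ bp; rewrite /Phi mxvecK plan_cost_perturb marginal_gap_perturb -Ep.
  rewrite -subr_ge0; move=> h; rewrite (le_trans h)// le_eqVlt; apply/orP; left.
  by apply/eqP; rewrite /u /w /ra /cb; field.
exists u, w; split => [i j|].
  rewrite leNgt; apply/negP => neg.
  (* This step stays in the box and keeps the second-order term [N * t] at most half of the
     violation. *)
  pose t := Num.min (3 - p i j) ((u i + w j - c i j) / (2 * N)).
  have tX : t <= 3 - p i j by rewrite ge_min lexx.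
  have tr : t <= (u i + w j - c i j) / (2 * N) by rewrite ge_min lexx orbT.
  have t0 : 0 < t.
    by rewrite lt_min subr_gt0 p3/= divr_gt0 ?mulr_gt0// subr_gt0.
  have : N * t <= (u i + w j - c i j) / 2.
    rewrite -ler_pdivlMl// (le_trans tr)// le_eqVlt; apply/orP; left.
    by apply/eqP; field; rewrite gt_eqF.
  have := @slope i j t; rewrite pmulr_rge0// => h1 h2.
  have : 0 <= p i j + t <= 3.
    rewrite addr_ge0 ?p0 ?ltW//=.
    by lra.
  by move/h1; lra.
have slack i j : c i j * p i j <= (u i + w j) * p i j.
  have := p0 i j; rewrite le_eqVlt => /predU1P[<-|pij]; first by rewrite !mulr0.
  rewrite ler_pM2r// leNgt; apply/negP => neg.
  pose t := Num.min (p i j) ((c i j - u i - w j) / (2 * N)).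
  have tX : t <= p i j by rewrite ge_min lexx.
  have tr : t <= (c i j - u i - w j) / (2 * N) by rewrite ge_min lexx orbT.
  have t0 : 0 < t.
    by rewrite lt_min pij/= divr_gt0 ?mulr_gt0//; lra.
  have : N * t <= (c i j - u i - w j) / 2.
    rewrite -ler_pdivlMl// (le_trans tr)// le_eqVlt; apply/orP; left.
    by apply/eqP; field; rewrite gt_eqF.
  have := @slope i j (- t); rewrite mulNr oppr_ge0 pmulr_rle0// mulrN => h1 h2.
  have : 0 <= p i j - t <= 3.
    by have := p3 i j; lra.
  by move/h1; lra.
(* Passing from the marginals of [p] to the prescribed ones adds a sum of squares to the dual value,
   hence can only raise it. *)
have -> : \sum_i u i * a i = \sum_i u i * ra i + \sum_i N * (a i - ra i) ^+ 2.
  by rewrite -big_split; apply: eq_bigr => i _; rewrite /u /=; ring.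
have -> : \sum_j w j * b j = \sum_j w j * cb j + \sum_j N * (b j - cb j) ^+ 2.
  by rewrite -big_split; apply: eq_bigr => i _; rewrite /w /=; ring.
have : plan_cost c p <= \sum_i u i * ra i + \sum_j w j * cb j.
  have -> : \sum_j w j * cb j = \sum_i \sum_j w j * p i j.
    by rewrite exchange_big; apply: eq_bigr => j _; rewrite mulr_sumr.
  rewrite -big_split ler_sum// => i _; rewrite mulr_sumr -big_split ler_sum// => j _.
  by rewrite /= -mulrDl.
have : 0 <= \sum_i N * (a i - ra i) ^+ 2.
  by rewrite sumr_ge0// => i _; rewrite mulr_ge0 ?sqr_ge0// ltW.
have : 0 <= \sum_j N * (b j - cb j) ^+ 2.
  by rewrite sumr_ge0// => i _; rewrite mulr_ge0 ?sqr_ge0// ltW.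
by lra.
Qed.
End finite_duality.
(** * Mixed second differences of a C2 cost *)

Section mean_value.
Context {R : realType}.

Lemma derivable_line (W : normedModType R) (f : W -> R) (z v : W) (t : R) :
  derivable f (z + t *: v) v ->
  is_derive t 1 (fun s => f (z + s *: v)) ('D_v f (z + t *: v)).
Proof.
move=> df.
have E : (fun h : R => h^-1 *: (f (z + (h *: (1 : R) + t) *: v) - f (z + t *: v))) =
         (fun h : R => h^-1 *: (f (h *: v + (z + t *: v)) - f (z + t *: v))).
  apply/funext => h; congr (_ *: (f _ - _)).
  by rewrite scalerDl addrCA; congr (_ *: _ + _); exact: mulr1.
by split; [rewrite /derivable /= E|rewrite /derive /= E].
Qed.

(** The segment joining 0 and [s] in either order, since coordinate increments have no fixed
    sign. *)
Definition between (t s : R) := (0 <= t <= s) || (s <= t <= 0).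

Lemma betweenxx s : between s s.
Proof. by rewrite /between !lexx andbT; exact: le_total. Qed.

Lemma between0 s : between 0 s.
Proof. by rewrite /between !lexx andbT; exact: le_total. Qed.

Lemma line_MVT (W : normedModType R) (f : W -> R) (z v : W) (s : R) :
  (forall t, between t s -> derivable f (z + t *: v) v) ->
  exists2 t, between t s &
    f (z + s *: v) - f z = s * 'D_v f (z + t *: v).
Proof.
have pos (y : W) (a : R) : 0 <= a ->
    (forall t, 0 <= t <= a -> derivable f (y + t *: v) v) ->
    exists2 t, 0 <= t <= a & f (y + a *: v) - f y = a * 'D_v f (y + t *: v).
  move=> a0 df.
  have dg t : 0 <= t <= a ->
      is_derive t 1 (fun s => f (y + s *: v)) ('D_v f (y + t *: v)).
    by move=> ta; apply: derivable_line; exact: df.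
  have [||t] := @MVT_segment R (fun s => f (y + s *: v))
    (fun s => 'D_v f (y + s *: v)) 0 a a0.
  - by move=> t; rewrite in_itv /= => /andP[t0 ta]; apply: dg; rewrite !ltW.
  - apply: derivable_within_continuous => t; rewrite in_itv /= => ta.
    by have [] := dg t ta.
  - rewrite in_itv /= => ta; rewrite scale0r addr0 subr0 => E.
    by exists t => //; rewrite E mulrC.
have [s0 df|s0 df] := leP 0 s.
  have [t ts E] := pos z s s0 (fun t ts => df t (introT orP (or_introl ts))).
  by exists t; rewrite /between ?ts.
have [||t ts E] := pos (z + s *: v) (- s).
- by rewrite oppr_ge0 ltW.
- by move=> t /andP[t0 ts]; rewrite -addrA -scalerDl; apply: df; apply/orP; right; lra.
- exists (s + t); first by apply/orP; right; lra.
  move: E; rewrite scaleNr addrK -addrA -scalerDl mulNr => E.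
  by rewrite -[RHS]opprK -E opprB.
Qed.

End mean_value.

Lemma near_dist_lt (R : realType) (T : topologicalType) (f : T -> R) (x : T) (eps : R) :
  {for x, continuous f} -> 0 < eps -> \forall y \near x, `|f y - f x| < eps.
Proof. by move=> /cvgrPdist_lt + eps0 => /(_ _ eps0); apply: filterS => y; rewrite distrC. Qed.

Lemma near_norm_lt (R : realType) (T : topologicalType) (f : T -> R) (x : T) :
  {for x, continuous f} -> exists2 L : R, 0 < L & \forall y \near x, `|f y| < L.
Proof.
move=> cf; exists (`|f x| + 1); first by rewrite ltr_wpDl.
apply: filterS (near_dist_lt cf ltr01) => y fy.
by rewrite -[f y](subrK (f x)) addrC (le_lt_trans (ler_normD _ _))// ltrD2l.
Qed.

Section mixed_difference.
Context {R : realType} {d : nat}.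
Local Notation V := 'rV[R]_d.
Implicit Types (x y : V) (z : V * V).

(** The open sup-norm ball written coordinatewise, so that it is visibly a box to which
    [lebesgue_rV_box] applies. *)
Definition near_pt (r : R) x x' := forall i, `|x' ord0 i - x ord0 i| < r.

Definition near_pair r z z' := near_pt r z.1 z'.1 /\ near_pt r z.2 z'.2.

Lemma nbhs_near_pair z (A : set (V * V)) : nbhs z A ->
  exists2 r, 0 < r & forall z', near_pair r z z' -> A z'.
Proof.
move=> /nbhs_ballP[r /= r0 rA]; exists r => // z' [h1 h2]; apply: rA.
by split; split => // i j; rewrite (ord1 i) -ball_normE /= distrC.
Qed.

Lemma near_pair_le r r' z z' : r <= r' -> near_pair r z z' -> near_pair r' z z'.
Proof. by move=> rr' [h1 h2]; split => i; apply: lt_le_trans rr'. Qed.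

(** Going from [x] to [x'] one coordinate at a time involves only derivatives along coordinate
    vectors, the ones that [mixed_hessian] records. *)
Definition row_switch x x' (k : nat) : V := \row_i (if (i < k)%N then x' ord0 i else x ord0 i).

Lemma row_switch0 x x' : row_switch x x' 0 = x.
Proof. by apply/rowP => i; rewrite mxE. Qed.

Lemma row_switchT x x' : row_switch x x' d = x'.
Proof. by apply/rowP => i; rewrite mxE ltn_ord. Qed.

Lemma row_switchS x x' (k : 'I_d) :
  row_switch x x' k.+1 = row_switch x x' k + (x' - x) ord0 k *: delta_mx ord0 k.
Proof.
apply/rowP => i; rewrite !mxE eqxx /= ltnS leq_eqVlt.
case: (altP (i =P k)) => [->|ik]; first by rewrite eqxx ltnn /= mulr1 addrC subrK.
by rewrite (negbTE (_ : val i != val k)) //= mulr0 addr0.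
Qed.

Lemma near_row_switch r x x0 x1 k t (i : 'I_d) : (k = i :> nat) ->
  near_pt r x x0 -> near_pt r x x1 ->
  between t ((x1 - x0) ord0 i) ->
  near_pt r x (row_switch x0 x1 k + t *: delta_mx ord0 i).
Proof.
move=> -> h0 h1; rewrite /between !mxE => ht j; rewrite !mxE eqxx /=.
case: (altP (j =P i)) => [->|ji]; last first.
  by rewrite mulr0 addr0; case: ifP.
rewrite ltnn mulr1; have := h0 i; have := h1 i; rewrite !ltr_norml.
case/orP: ht; lra.
Qed.

Lemma telescope_row_switch (F : V -> R) x x' :
  F x' - F x = \sum_(k < d) (F (row_switch x x' k.+1) - F (row_switch x x' k)).
Proof.
rewrite -(big_mkord xpredT (fun k => F (row_switch x x' k.+1) - F (row_switch x x' k))).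
by rewrite telescope_sumr// row_switch0 row_switchT.
Qed.

Lemma derivable_snd (c : V * V -> R) x y v : derivable c (x, y) (0, v) ->
  is_derive y v (fun y => c (x, y)) ('D_(0, v) c (x, y)).
Proof.
move=> dc.
have E : (fun h : R => h^-1 *: (c (x, h *: v + y) - c (x, y))) =
         (fun h : R => h^-1 *: (c (h *: (0, v) + (x, y)) - c (x, y))).
  by apply/funext => h;
  rewrite (_ : h *: (0, v) + (x, y) = (x, h *: v + y))//; congr pair; rewrite /= scaler0 add0r.
by split; [rewrite /derivable /= E|rewrite /derive /= E].
Qed.

Variables (c : V * V -> R) (U : set (V * V)).
Hypotheses (oU : open U) (cC2 : C2_on U c).

(** The amount saved when [z] and [z'] exchange their second components. *)
Definition cross_difference z z' :=
  c z + c z' - c (z.1, z'.2) - c (z'.1, z.2).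

Definition sum_norm (v : V) := \sum_i `|v ord0 i|.

Definition mx_pairing (A : 'M[R]_d) (u v : V) := \sum_i \sum_j A i j * u ord0 i * v ord0 j.

Let e (i : 'I_d) : V := delta_mx ord0 i.

Lemma mixed_hessianE z i j : mixed_hessian c z i j = 'D_(e i, 0) ('D_(0, e j) c) z.
Proof. by rewrite /mixed_hessian mxE. Qed.

(** The cross difference is a sum over coordinate rectangles, each contributing a mixed derivative
    at an intermediate point times two increments. Near [z0] these derivatives are within [kappa] of
    their values at [z0]. The tolerance is free, so it can later be adapted to the inverse of the
    Hessian. *)
Lemma cross_difference_approx z0 (kappa : R) : U z0 -> 0 < kappa ->
  exists2 r, 0 < r & forall z z', near_pair r z0 z -> near_pair r z0 z' ->
    `|cross_difference z z' - mx_pairing (mixed_hessian c z0) (z'.1 - z.1) (z'.2 - z.2)|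
      <= kappa * (sum_norm (z'.1 - z.1) * sum_norm (z'.2 - z.2)).
Proof.
move=> Uz0 k0.
pose h i j z := 'D_(e i, 0) ('D_(0, e j) c) z.
have [r r0 rP] : exists2 r, 0 < r & forall z, near_pair r z0 z ->
    U z /\ forall i j, `|h i j z - h i j z0| < kappa.
  have near_U : nbhs z0 U by exact: open_nbhs_nbhs.
  have near_H : \forall z \near z0, forall i j,
      `|h i j z - h i j z0| < kappa.
    suff H i j : \forall z \near z0, `|h i j z - h i j z0| < kappa.
      pose P i j := [set z | `|h i j z - h i j z0| < kappa].
      apply: (@filter_forall _ 'I_d (fun i z => forall j, P i j z) (nbhs z0)) => i.
      by apply: (@filter_forall _ 'I_d (P i) (nbhs z0)) => j; exact: H.
    have [_ cH] := cC2.2 (0, e j) (e i, 0) z0 Uz0.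
    exact: near_dist_lt cH k0.
  exact: nbhs_near_pair (filterI near_U near_H).
exists r => // z z' rz rz'; pose x k := row_switch z.1 z'.1 k; pose y k := row_switch z.2 z'.2 k.
pose S (k l : 'I_d) := c (x k.+1, y l.+1) - c (x k.+1, y l) - c (x k, y l.+1) + c (x k, y l).
have -> : cross_difference z z' = \sum_k \sum_l S k l.
  rewrite /cross_difference.
  transitivity ((c (z'.1, z'.2) - c (z.1, z'.2)) - (c (z'.1, z.2) - c (z.1, z.2))).
    by rewrite -!surjective_pairing; ring.
  rewrite (telescope_row_switch (fun x => c (x, z'.2) ) z.1 z'.1).
  rewrite (telescope_row_switch (fun x => c (x, z.2) ) z.1 z'.1) -sumrB.
  apply: eq_bigr => k _.
  have := telescope_row_switch (fun y => c (x k.+1, y) - c (x k, y)) z.2 z'.2 => ->.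
  by apply: eq_bigr => l _; rewrite /S; ring.
have SE k l : exists2 zeta, near_pair r z0 zeta &
    S k l = h k l zeta * (z'.1 - z.1) ord0 k * (z'.2 - z.2) ord0 l.
  (* [mixed_hessian] differentiates in the second variable first. The mean value theorem is
     therefore applied to the [x]-increment as a function of [y], then to the [y]-derivative as a
     function of [x], and symmetry of second derivatives is not called upon. *)
  pose f := (fun y => c (x k.+1, y)) - (fun y => c (x k, y)).
  have near_xy t u : between t ((z'.1 - z.1) ord0 k) ->
      between u ((z'.2 - z.2) ord0 l) ->
      near_pair r z0 (x k + t *: e k, y l + u *: e l).
    by move=> ht hu; split; apply: near_row_switch => //; [case: rz|case: rz'|case: rz|case: rz'].
  have df u : between u ((z'.2 - z.2) ord0 l) ->
      is_derive (y l + u *: e l) (e l) f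
        ('D_(0, e l) c (x k.+1, y l + u *: e l) - 'D_(0, e l) c (x k, y l + u *: e l)).
    move=> hu; apply: is_deriveB; apply: derivable_snd; apply: (cC2.1 (0, e l) _ _).1.
      by rewrite /x row_switchS; have [] := rP _ (near_xy _ _ (betweenxx _) hu).
    by have [] := rP _ (near_xy _ _ (between0 _) hu); rewrite scale0r addr0.
  have [u hu fE] := line_MVT (fun u hu => @ex_derive _ _ _ _ _ _ _ (df u hu)).
  have Uxy t : between t ((z'.1 - z.1) ord0 k) ->
      U ((x k, y l + u *: e l) + t *: (e k, 0)).
    move=> ht; have [+ _] := rP _ (near_xy _ _ ht hu).
    rewrite (_ : (x k, y l + u *: e l) + t *: (e k, 0) = (x k + t *: e k, y l + u *: e l))//.
    by congr pair; rewrite /= scaler0 addr0.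
  have [t ht] := line_MVT (fun t ht => (cC2.2 (0, e l) (e k, 0) _ (Uxy t ht)).1).
  have xS : (x k, y l + u *: e l) + (z'.1 - z.1) ord0 k *: (e k, 0) = (x k.+1, y l + u *: e l).
    by congr pair; rewrite /= ?scaler0 ?addr0// /x row_switchS.
  have xt : (x k, y l + u *: e l) + t *: (e k, 0) = (x k + t *: e k, y l + u *: e l).
    by congr pair; rewrite /= scaler0 addr0.
  rewrite xS xt -/(h k l _) => DE.
  exists (x k + t *: e k, y l + u *: e l); first exact: near_xy.
  have -> : S k l = f (y l + (z'.2 - z.2) ord0 l *: e l) - f (y l).
    by rewrite /S /f /y -row_switchS !fctE; ring.
  rewrite fE (@derive_val _ _ _ _ _ _ _ (df u hu)) DE.
  move: (h k l _) => a; ring.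
rewrite /mx_pairing -sumrB (le_trans (ler_norm_sum _ _ _))//.
rewrite /sum_norm mulr_suml mulr_sumr ler_sum// => k _.
rewrite mulr_sumr mulr_sumr -sumrB (le_trans (ler_norm_sum _ _ _))// ler_sum// => l _.
have [zeta /rP[_ Hz] ->] := SE k l; rewrite mixed_hessianE -/(h k l z0).
rewrite -!mulrBl !normrM -mulrA ler_wpM2r ?mulr_ge0// ltW//.
Qed.

Lemma near_near_pair z r : 0 < r -> \forall z' \near z, near_pair r z z'.
Proof.
move=> r0; apply/nbhs_ballP; exists r => //= z' [[_ h1] [_ h2]].
by split=> i; [have := h1 ord0 i|have := h2 ord0 i]; rewrite -ball_normE /= distrC.
Qed.

Lemma sum_norm_le r x x' : near_pt r x x' -> sum_norm (x' - x) <= d%:R * r.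
Proof.
move=> h; rewrite /sum_norm (@le_trans _ _ (\sum_(i < d) r))//.
  by apply: ler_sum => i _; rewrite !mxE ltW.
by rewrite sumr_const card_ord mulr_natl.
Qed.

(** [C1_on] speaks of directional derivatives only. Their continuity bounds the partial derivatives
    near [z0], and walking along the coordinates turns this into a Lipschitz estimate at [z0]. *)
Lemma C2_continuous z0 : U z0 -> {for z0, continuous c}.
Proof.
move=> Uz0.
have bnd v : exists2 L, 0 < L & \forall z \near z0, `|'D_v c z| < L.
  by have [_ cD] := cC2.1 v z0 Uz0; exact: near_norm_lt cD.
have {bnd}[L L0 Lv] : exists2 L, 0 < L & forall i, \forall z \near z0,
    `|'D_(e i, 0) c z| < L /\ `|'D_(0, e i) c z| < L.
  have /choice[L1] : forall i, exists L, 0 < L /\ \forall z \near z0, `|'D_(e i, 0) c z| < L.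
    by move=> i; have [L L0 H] := bnd (e i, 0); exists L.
  have /choice[L2] : forall i, exists L, 0 < L /\ \forall z \near z0, `|'D_(0, e i) c z| < L.
    by move=> i; have [L L0 H] := bnd (0, e i); exists L.
  move=> L2P L1P.
  exists (1 + \sum_i (L1 i + L2 i)).
    by rewrite ltr_pwDl// sumr_ge0// => i _; have [? _] := L1P i; have [? _] := L2P i;
      rewrite addr_ge0// ltW.
  move=> i; have [L10 nL1] := L1P i; have [L20 nL2] := L2P i.
  have : L1 i + L2 i <= 1 + \sum_i (L1 i + L2 i).
    rewrite (bigD1 i)//= addrCA lerDl addr_ge0// sumr_ge0// => j _.
    by have [? _] := L1P j; have [? _] := L2P j; rewrite addr_ge0// ltW.
  move=> le; apply: filterS2 nL1 nL2 => z h1 h2.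
  by split; [apply: lt_le_trans h1 _|apply: lt_le_trans h2 _]; lra.
have [r r0 rP] : exists2 r, 0 < r & forall z, near_pair r z0 z ->
    U z /\ forall i, `|'D_(e i, 0) c z| < L /\ `|'D_(0, e i) c z| < L.
  have near_U : nbhs z0 U by exact: open_nbhs_nbhs.
  apply: nbhs_near_pair (filterI near_U _).
  pose P i := [set z | `|'D_(e i, 0) c z| < L /\ `|'D_(0, e i) c z| < L].
  exact: (@filter_forall _ 'I_d P (nbhs z0)).
have lip z : near_pair r z0 z ->
    `|c z - c z0| <= L * (sum_norm (z.1 - z0.1) + sum_norm (z.2 - z0.2)).
  move=> rz.
  have rz0 : near_pair r z0 z0 by split=> i; rewrite subrr normr0.
  have -> : c z - c z0 = (c (z.1, z.2) - c (z0.1, z.2)) + (c (z0.1, z.2) - c (z0.1, z0.2)).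
    by rewrite -!surjective_pairing; ring.
  rewrite (telescope_row_switch (fun x => c (x, z.2)) z0.1 z.1).
  rewrite (telescope_row_switch (fun y => c (z0.1, y)) z0.2 z.2).
  rewrite (le_trans (ler_normD _ _))// mulrDr /sum_norm !mulr_sumr.
  apply: lerD; apply: le_trans (ler_norm_sum _ _ _) _; apply: ler_sum => k _.
    have E t : (row_switch z0.1 z.1 k + t *: e k, z.2) = (row_switch z0.1 z.1 k, z.2) + t *: (e k, 0).
      by congr pair; rewrite /= scaler0 addr0.
    have rt t : between t ((z.1 - z0.1) ord0 k) ->
        near_pair r z0 ((row_switch z0.1 z.1 k, z.2) + t *: (e k, 0)).
      by move=> ht; rewrite -E; split; [apply: near_row_switch ht => //; [case: rz0|case: rz]|case: rz].
    rewrite row_switchS E.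
    have [|t /rt/rP[_ /(_ k)[DL _]] ->] := @line_MVT _ _ c (row_switch z0.1 z.1 k, z.2)
      (e k, 0) ((z.1 - z0.1) ord0 k).
      by move=> t /rt/rP[Uz _]; have [] := cC2.1 (e k, 0) _ Uz.
    by rewrite normrM mulrC ler_wpM2r// ltW.
  have E t : (z0.1, row_switch z0.2 z.2 k + t *: e k) = (z0.1, row_switch z0.2 z.2 k) + t *: (0, e k).
    by congr pair; rewrite /= scaler0 addr0.
  have rt t : between t ((z.2 - z0.2) ord0 k) ->
      near_pair r z0 ((z0.1, row_switch z0.2 z.2 k) + t *: (0, e k)).
    by move=> ht; rewrite -E; split; [case: rz0|apply: near_row_switch ht => //; [case: rz0|case: rz]].
  rewrite row_switchS E.
  have [|t /rt/rP[_ /(_ k)[_ DL]] ->] := @line_MVT _ _ c (z0.1, row_switch z0.2 z.2 k)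
    (0, e k) ((z.2 - z0.2) ord0 k).
    by move=> t /rt/rP[Uz _]; have [] := cC2.1 (0, e k) _ Uz.
  by rewrite normrM mulrC ler_wpM2r// ltW.
apply/cvgrPdist_le => eps eps0.
pose K : R := L * (2 * d%:R) + 1.
have K0 : 0 < K by rewrite ltr_wpDl// !mulr_ge0// ltW.
have m0 : 0 < Num.min r (eps / K) by rewrite lt_min r0 divr_gt0.
apply: filterS (near_near_pair z0 m0) => z mz.
have mr : near_pair r z0 z by apply: near_pair_le mz; rewrite ge_min lexx.
have [m1 m2] : near_pair (eps / K) z0 z by apply: near_pair_le mz; rewrite ge_min lexx orbT.
rewrite distrC (le_trans (lip z mr))//.
rewrite (@le_trans _ _ (L * (2 * d%:R) * (eps / K)))//.
  rewrite -mulrA ler_pM2l//; have := sum_norm_le m1; have := sum_norm_le m2; lra.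
rewrite mulrA ler_pdivrMr// mulrC ler_pM2l// /K; lra.
Qed.

End mixed_difference.
(** * Small cross differences and Minty coordinates *)

Section minty.
Context {R : realType} {d : nat}.
Local Notation V := 'rV[R]_d.
Implicit Types (x y u v : V) (z : V * V) (A : 'M[R]_d).

Lemma mx_pairingE A u v : mx_pairing A u v = \sum_j (u *m A) ord0 j * v ord0 j.
Proof.
rewrite /mx_pairing exchange_big; apply: eq_bigr => j _; rewrite mxE mulr_suml.
by apply: eq_bigr => i _; rewrite [A i j * _]mulrC.
Qed.

Definition mx_sum_norm A := \sum_i \sum_j `|A i j|.

Lemma sum_norm_mulmx A u : sum_norm (u *m A) <= sum_norm u * mx_sum_norm A.
Proof.
rewrite /sum_norm mulr_suml.
rewrite (@le_trans _ _ (\sum_j \sum_i `|u ord0 i| * `|A i j|))//.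
  apply: ler_sum => j _; rewrite mxE (le_trans (ler_norm_sum _ _ _))//.
  by apply: ler_sum => i _; rewrite normrM.
rewrite exchange_big ler_sum// => i _; rewrite -mulr_sumr ler_wpM2l//.
by rewrite /mx_sum_norm [leRHS](bigD1 i)//= lerDl sumr_ge0// => k _; rewrite sumr_ge0.
Qed.

Lemma entry_le_sum_norm u i : `|u ord0 i| <= sum_norm u.
Proof. by rewrite /sum_norm (bigD1 i)//= lerDl sumr_ge0. Qed.

Lemma sum_norm_ge0 u : 0 <= sum_norm u.
Proof. by rewrite sumr_ge0. Qed.

Lemma mx_sum_norm_ge0 A : 0 <= mx_sum_norm A.
Proof. by rewrite sumr_ge0// => i _; rewrite sumr_ge0. Qed.

Lemma sum_norm_mul_le u v : sum_norm u * sum_norm v <=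
  d%:R / 2 * (\sum_j u ord0 j ^+ 2 + \sum_j v ord0 j ^+ 2).
Proof.
rewrite /sum_norm mulr_suml.
rewrite (@le_trans _ _ (\sum_i \sum_j (u ord0 i ^+ 2 + v ord0 j ^+ 2) / 2))//.
  apply: ler_sum => i _; rewrite mulr_sumr ler_sum// => j _.
  rewrite -(real_normK (num_real (u ord0 i))) -(real_normK (num_real (v ord0 j))).
  have := sqr_ge0 (`|u ord0 i| - `|v ord0 j|); rewrite sqrrB; lra.
under eq_bigr do rewrite -mulr_suml big_split /= sumr_const card_ord.
rewrite -mulr_suml big_split /= sumr_const card_ord sumrMnl -mulrnDl -[_ *+ d]mulr_natl.
by rewrite [leRHS]mulrAC.
Qed.

(* Minty's change of variables: with xi = u A, p = xi + v and q = xi - v, the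
   pairing <xi, v> is (|p|^2 - |q|^2) / 4. *)
Lemma minty_bound A (s kappa : R) u v :
  A \in unitmx -> 0 <= s -> 0 <= kappa ->
  kappa * mx_sum_norm (invmx A) * d%:R <= 2^-1 ->
  mx_pairing A u v - kappa * (sum_norm u * sum_norm v) <= 4 * s ^+ 2 ->
  (forall j, `|(u *m A - v) ord0 j| <= s) ->
  forall j, `|(u *m A) ord0 j| <= (33 + 3 * d%:R) * s /\
            `|v ord0 j| <= (33 + 3 * d%:R) * s.
Proof.
move=> Au s0 k0 kA gain qs.
pose xi := u *m A; pose S := \sum_j xi ord0 j ^+ 2 + \sum_j v ord0 j ^+ 2.
have S0 : 0 <= S by rewrite addr_ge0// sumr_ge0// => j _; rewrite sqr_ge0.
(* The smallness of [kappa] lets the linearization error be absorbed by a quarter of [S]. *)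
have err : kappa * (sum_norm u * sum_norm v) <= S / 4.
  have -> : u = xi *m invmx A by rewrite /xi mulmxK.
  rewrite (@le_trans _ _ (kappa * (sum_norm xi * mx_sum_norm (invmx A) * sum_norm v)))//.
    by rewrite ler_wpM2l// ler_wpM2r ?sum_norm_ge0// sum_norm_mulmx.
  have -> : kappa * (sum_norm xi * mx_sum_norm (invmx A) * sum_norm v) =
      kappa * mx_sum_norm (invmx A) * (sum_norm xi * sum_norm v) by ring.
  rewrite (@le_trans _ _ (kappa * mx_sum_norm (invmx A) * (d%:R / 2 * S)))//.
    by rewrite ler_wpM2l ?mulr_ge0 ?mx_sum_norm_ge0 ?sum_norm_mul_le.
  have -> : kappa * mx_sum_norm (invmx A) * (d%:R / 2 * S) =
      kappa * mx_sum_norm (invmx A) * d%:R * (S / 2) by ring.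
  rewrite (@le_trans _ _ (2^-1 * (S / 2)))//; first by rewrite ler_wpM2r// divr_ge0.
  by rewrite le_eqVlt; apply/orP; left; apply/eqP; field.
have sum_p : \sum_j (xi ord0 j + v ord0 j) ^+ 2 <= 32 * s ^+ 2 + 3 * (d%:R * s ^+ 2).
  have qs2 : \sum_j (xi ord0 j - v ord0 j) ^+ 2 <= d%:R * s ^+ 2.
    rewrite (@le_trans _ _ (\sum_(j < d) s ^+ 2))//; last first.
      by rewrite sumr_const card_ord mulr_natl.
    apply: ler_sum => j _; have := qs j; rewrite !mxE -/xi.
    by rewrite -[(_ - _) ^+ 2]real_normK ?num_real// ler_sqr ?nnegrE.
  (* With m the pairing, |p|^2 = S + 2m and |q|^2 = S - 2m, hence |p|^2 = 8 (m - S/4) + 3 |q|^2. The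
     subtracted S/4 is what pays for [err]. *)
  have : \sum_j (xi ord0 j + v ord0 j) ^+ 2 =
      8 * (mx_pairing A u v - S / 4) + 3 * \sum_j (xi ord0 j - v ord0 j) ^+ 2.
    rewrite mx_pairingE -/xi /S (eq_bigr (fun j => (8 * (xi ord0 j * v ord0 j)
      - 2 * (xi ord0 j ^+ 2 + v ord0 j ^+ 2)) + 3 * (xi ord0 j - v ord0 j) ^+ 2)).
      by rewrite big_split /= sumrB -!mulr_sumr big_split /=; field.
    by move=> j _; ring.
  lra.
move=> j; have qj : `|xi ord0 j - v ord0 j| <= s by have := qs j; rewrite mxE [(- v) _ _]mxE.
have : `|xi ord0 j + v ord0 j| <= (32 + 3 * d%:R) * s.
  rewrite -ler_sqr ?nnegrE ?mulr_ge0 ?addr_ge0// real_normK ?num_real//.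
  rewrite (@le_trans _ _ (32 * s ^+ 2 + 3 * (d%:R * s ^+ 2)))//.
    by rewrite (le_trans _ sum_p)// (bigD1 j)//= lerDl sumr_ge0// => k _; rewrite sqr_ge0.
  rewrite exprMn [leLHS](_ : _ = (32 + 3 * d%:R) * s ^+ 2); last by ring.
  rewrite ler_wpM2r ?sqr_ge0// expr2 ler_peMr ?addr_ge0//.
  by have := ler0n R d; lra.
move: qj; rewrite !ler_norml => qj pj.
by split; apply/andP; split; lra.
Qed.

Variables (c : V * V -> R) (U : set (V * V)).
Hypotheses (oU : open U) (cC2 : C2_on U c).

(* The grid is laid on the Minty coordinate q = x A - y, on whose cells the other
   coordinate x A + y has oscillation O(s). *)
Lemma local_cover z0 : U z0 -> mixed_hessian c z0 \in unitmx ->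
  exists r L : R, [/\ 0 < r, 0 < L & forall s (S : set (V * V)), 0 < s <= 1 ->
    (forall z, S z -> near_pair r z0 z) ->
    (forall z z', S z -> S z' -> cross_difference c z z' <= 4 * s ^+ 2) ->
    exists N (w : {ffun 'I_d -> 'I_N} -> V * V), N%:R * s <= L /\
      forall z, S z -> exists f, near_pair (L * s) (w f) z].
Proof.
move=> Uz0 Au; set A := mixed_hessian c z0 in Au *.
pose a := mx_sum_norm A; pose b := mx_sum_norm (invmx A).
have a0 : 0 <= a := mx_sum_norm_ge0 A.
have b0 : 0 <= b := mx_sum_norm_ge0 (invmx A).
(* The tolerance that [minty_bound] asks for; the added 1 keeps the denominator positive. *)
pose kappa : R := (2 * (b * d%:R + 1))^-1.
have bd1 : 0 < b * d%:R + 1 by rewrite ltr_wpDl// mulr_ge0.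
have kappa0 : 0 < kappa by rewrite invr_gt0 mulr_gt0.
have kappaA : kappa * b * d%:R <= 2^-1.
  rewrite /kappa invfM -!mulrA ler_piMr// mulrC ler_pdivrMr// mul1r; lra.
have [r r0 rP] := cross_difference_approx oU cC2 Uz0 kappa0.
pose B : R := d%:R * r * a + r.
have B0 : 0 <= B by rewrite addr_ge0 ?mulr_ge0// ltW.
pose L1 : R := (33 + 3 * d%:R).
have L10 : 0 < L1 by rewrite /L1; have := ler0n R d; lra.
(* The first summand bounds [N%:R * s], the second the [y]-increments, the third the [x]-increments,
   which are recovered from [u *m A] through the inverse of [A]. *)
pose L : R := (2 * B + 1) + (L1 + 1) + d%:R * L1 * b.
have dLb : 0 <= d%:R * L1 * b by rewrite !mulr_ge0// ltW.
have L0 : 0 < L by rewrite /L; lra.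
exists r, L; split=> // s S /andP[s0 s1] Sr Sgain.
pose q z := z.1 *m A - z.2.
have qB z : S z -> forall j, `|(q z - q z0) ord0 j| <= B.
  move=> /Sr[h1 h2] j.
  have -> : q z - q z0 = (z.1 - z0.1) *m A - (z.2 - z0.2).
    by rewrite /q mulmxBl; apply/rowP => k; rewrite !mxE; ring.
  rewrite mxE [X in _ + X]mxE (le_trans (ler_normB _ _))// lerD//; last first.
    by rewrite !mxE ltW.
  rewrite (le_trans (entry_le_sum_norm _ _))// (le_trans (sum_norm_mulmx _ _))//.
  by rewrite ler_wpM2r// sum_norm_le.
pose g z j := ((q z - q z0) ord0 j + B) / s.
have g0 z j : S z -> 0 <= g z j.
  by move=> Sz; rewrite divr_ge0 ?(ltW s0)//; have := qB z Sz j; rewrite ler_norml; lra.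
pose N := (Num.truncn (2 * B / s)).+1.
have Ns : N%:R * s <= L.
  rewrite /N -natr1 mulrDl mul1r.
  have : (Num.truncn (2 * B / s))%:R * s <= 2 * B.
    by rewrite -ler_pdivlMr// truncn_le// divr_ge0 ?mulr_ge0// ltW.
  rewrite /L; lra.
have gN z j : S z -> (Num.truncn (g z j) < N)%N.
  move=> Sz; rewrite ltnS le_truncn// ler_pM2r ?invr_gt0//.
  by have := qB z Sz j; rewrite ler_norml; lra.
pose idx z : {ffun 'I_d -> 'I_N} := [ffun j => inord (Num.truncn (g z j))].
have same z z' : S z -> S z' -> idx z = idx z' ->
    forall j, `|(q z' - q z) ord0 j| <= s.
  move=> Sz Sz' /ffunP + j => /(_ j); rewrite !ffunE => /(congr1 val) /=.
  rewrite !inordK ?gN// => E.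
  have := truncn_itv (g0 z j Sz); have := truncn_itv (g0 z' j Sz'); rewrite E.
  set n := Num.truncn _; rewrite -natr1 => /andP[h1 h2] /andP[h3 h4].
  have Eg : (q z' - q z) ord0 j = (g z' j - g z j) * s.
    by rewrite /g -mulrBl divfK ?gt_eqF// !mxE; ring.
  rewrite Eg normrM (gtr0_norm s0) ler_piMl ?(ltW s0)// ler_norml; lra.
have near_same z z' : S z -> S z' -> idx z = idx z' -> near_pair (L * s) z z'.
  move=> Sz Sz' E; pose u : V := z'.1 - z.1; pose v : V := z'.2 - z.2.
  have qs j : `|(u *m A - v) ord0 j| <= s.
    have <- : q z' - q z = u *m A - v; last exact: same.
    by rewrite /q /u /v mulmxBl; apply/rowP => k; rewrite !mxE; ring.
  have gain : mx_pairing A u v - kappa * (sum_norm u * sum_norm v) <= 4 * s ^+ 2.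
    have := rP z z' (Sr _ Sz) (Sr _ Sz'); rewrite -/A -/u -/v ler_norml.
    have := Sgain z z' Sz Sz'; lra.
  have uv := minty_bound Au (ltW s0) (ltW kappa0) kappaA gain qs.
  have L1s : L1 * s < L * s by rewrite ltr_pM2r// /L; lra.
  split=> j; last first.
    by have [_ +] := uv j; rewrite !mxE => h; rewrite (le_lt_trans h).
  have -> : z'.1 ord0 j - z.1 ord0 j = u ord0 j by rewrite !mxE.
  rewrite (le_lt_trans (entry_le_sum_norm _ _))//.
  have -> : u = (u *m A) *m invmx A by rewrite mulmxK.
  rewrite (le_lt_trans (sum_norm_mulmx _ _))//.
  have : sum_norm (u *m A) <= d%:R * (L1 * s).
    rewrite /sum_norm (@le_trans _ _ (\sum_(i < d) L1 * s))//.
      by apply: ler_sum => i _; have [] := uv i.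
    by rewrite sumr_const card_ord mulr_natl.
  move=> /(ler_wpM2r b0)/le_lt_trans; apply.
  rewrite (_ : d%:R * (L1 * s) * b = d%:R * L1 * b * s); last by ring.
  by rewrite ltr_pM2r// /L; lra.
(* Indices of empty cells receive the dummy centre [z0]. *)
have /choice[w wP] : forall f, exists w, forall z, S z -> idx z = f -> near_pair (L * s) w z.
  move=> f; have [[z [Sz zf]]|nf] := pselect (exists z, S z /\ idx z = f).
    by exists z => z' Sz' z'f; apply: near_same => //; rewrite zf z'f.
  by exists z0 => z Sz zf; exfalso; apply: nf; exists z.
by exists N, w; split=> // z Sz; exists (idx z); exact: wP.
Qed.

End minty.

(** * Finite covers and the mass of sets with small cross differences *)

Lemma compact_finite_cover (T : topologicalType) (A : set T) : compact A -> cover_compact A.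
Proof.
have [->|/set0P[x0 _]] := eqVneq A set0.
  by move=> _ I D f _ _; exists finmap.fset0 => // i; rewrite ?inE.
pose T' : ptopologicalType := HB.pack_for ptopologicalType T (isPointed.Build T x0).
move=> cA; suff: @cover_compact T' A by [].
by rewrite -compact_cover.
Qed.

Lemma measure_le_cover d (T : measurableType d) (R : realType)
    (mu : {measure set T -> \bar R}) (I : choiceType) (s : seq I) (F : I -> set T)
    (b : I -> R) (S : set T) :
  measurable S -> (forall i, i \in s -> measurable (F i)) ->
  (forall i, i \in s -> mu (F i) <= (b i)%:E)%E ->
  (forall z, S z -> exists2 i, i \in s & F i z) ->
  (mu S <= (\sum_(i <- s) b i)%:E)%E.
Proof.
move=> mS mF Fb SF; pose F' i := if i \in s then F i else set0.
have mF' i : measurable (F' i) by rewrite /F'; case: ifPn => // /mF.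
have mU (s' : seq I) : measurable (\big[setU/set0]_(i <- s') F' i) by exact: bigsetU_measurable.
apply: (@le_trans _ _ (mu (\big[setU/set0]_(i <- s) F' i))).
  apply: le_measure; rewrite ?inE// => z /SF[i si Fz].
  by rewrite -bigcup_seq; exists i => //; rewrite /F' si.
have Fb' : forall i, i \in s -> (mu (F' i) <= (b i)%:E)%E.
  by move=> i si; rewrite /F' si; exact: Fb.
elim: s {mF Fb SF} F' mF' mU Fb' => [|i s IH] F' mF' mU Fb'.
  by rewrite !big_nil measure0.
rewrite !big_cons EFinD (le_trans (measureU2 _ _ _))// leeD ?Fb' ?mem_head//.
by apply: IH => // j sj; apply: Fb'; rewrite inE sj orbT.
Qed.

Section density.
Context {R : realType} {d : nat}.
Local Notation V := 'rV[R]_d.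

Lemma measurable_near_pt r (x : V) : measurable (near_pt r x).
Proof.
rewrite (_ : near_pt r x = \bigcap_(i in [set: 'I_d])
    ((fun v : V => v ord0 i) @^-1` ball (x ord0 i) r)).
  apply: fin_bigcap_measurable => // i _; rewrite -[X in measurable X]setTI.
  apply: (continuous_measurable_rV (@coord_continuous R 1 d ord0 i)) => //.
  by apply: open_measurable; exact: ball_open.
by apply/seteqP; split=> v /= vA i; [move=> _|]; have := vA i;
  rewrite -ball_normE /= distrC//; apply.
Qed.

Lemma near_pairE r (z : V * V) : near_pair r z = near_pt r z.1 `*` near_pt r z.2.
Proof. by []. Qed.

Lemma measurable_near_pair r (z : V * V) : measurable (near_pair r z).
Proof. by rewrite near_pairE; apply: measurableX; exact: measurable_near_pt. Qed.

Lemma bounded_density_near_pt (mu : probability V R) : bounded_density mu ->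
  exists2 M : R, 0 <= M & forall x r, 0 <= r ->
    (mu (near_pt r x) <= (M * (2 * r) ^+ d)%:E)%E.
Proof.
move=> [g [mg g0 [M gM] muE]].
have M0 : 0 <= M by exact: le_trans (g0 0) (gM 0).
exists M => // x r r0; rewrite muE; last exact: measurable_near_pt.
apply: (@le_trans _ _ (\int[lebesgue_rV d]_(v in near_pt r x) M%:E)%E).
  apply: ge0_le_integral => //; first exact: measurable_near_pt.
  - by move=> v _; rewrite lee_fin.
  - by apply/measurable_EFinP; apply: measurable_funS mg.
  - by move=> v _; rewrite lee_fin.
rewrite integral_cst; last exact: measurable_near_pt.
rewrite (_ : near_pt r x = [set v | forall i, ball (x ord0 i) r (v ord0 i)]); last first.
  apply/seteqP; split=> v /= vA i; have := vA i; by rewrite -ball_normE /= distrC.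
have mball i : measurable (ball (x ord0 i) r : set (measurableTypeR R)).
  by apply: open_measurable; exact: ball_open.
rewrite [X in (_ * X)%E](_ : _ = \prod_(i < d)
  lebesgue_measure (ball (x ord0 i) r : set (measurableTypeR R)))%E;
  last exact: (lebesgue_rV_box mball).
rewrite (eq_bigr (fun=> (2 * r)%:E)) => [|i _].
  by rewrite prodEFin prodr_const card_ord -EFinM.
by rewrite lebesgue_measure_ball// mulr_natl.
Qed.

End density.

Section gain_measure.
Context {R : realType} {d : nat}.
Local Notation V := 'rV[R]_d.
Variables (mu1 mu2 : probability V R) (X : set (V * V)) (c : V * V -> R).
Hypotheses (mu1_density : bounded_density mu1) (mu2_density : bounded_density mu2).
Hypotheses (X_compact : compact X) (c_C2 : C2_near X c).
Hypothesis (c_nondegenerate : nondegenerate_cost X c).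

(** Locally there are [N ^ d] boxes with [N] of order 1/s, each of product mass of order [s ^ (2d)].
    Compactness leaves finitely many base points, whose constants are added. The constant is fixed
    before [s] and [S], so it survives the refinement of partitions. *)
Lemma small_gain_measure : exists2 C : R, 0 < C & forall s (S : set (V * V)),
  0 < s -> measurable S -> S `<=` X ->
  (forall z z', S z -> S z' -> cross_difference c z z' <= 4 * s ^+ 2) ->
  ((mu1 \x mu2) S <= (C * s ^+ d)%:E)%E.
Proof.
have [U [oU XU cC2]] := c_C2.
have [M1 M10 mu1M] := bounded_density_near_pt mu1_density.
have [M2 M20 mu2M] := bounded_density_near_pt mu2_density.
have /choice[r /choice[L rL]] : forall z0, exists r L : R, X z0 -> [/\ 0 < r, 0 < L &
    forall s (S : set (V * V)), 0 < s <= 1 ->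
    (forall z, S z -> near_pair r z0 z) ->
    (forall z z', S z -> S z' -> cross_difference c z z' <= 4 * s ^+ 2) ->
    exists N (w : {ffun 'I_d -> 'I_N} -> V * V), N%:R * s <= L /\
      forall z, S z -> exists f, near_pair (L * s) (w f) z].
  move=> z0; have [Xz0|nX] := pselect (X z0); last by exists 0, 0.
  by have [r [L rL]] := local_cover oU cC2 (XU _ Xz0) (c_nondegenerate Xz0); exists r, L.
pose K z0 := L z0 ^+ d * (M1 * (2 * L z0) ^+ d * (M2 * (2 * L z0) ^+ d)).
have K0 z : X z -> 0 <= K z.
  by move=> /rL[_ L0 _]; rewrite !mulr_ge0// exprn_ge0// ?mulr_ge0// ltW.
have local z0 s (S : set (V * V)) : X z0 -> 0 < s <= 1 -> measurable S ->
    (forall z, S z -> near_pair (r z0) z0 z) ->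
    (forall z z', S z -> S z' -> cross_difference c z z' <= 4 * s ^+ 2) ->
    ((mu1 \x mu2) S <= (K z0 * s ^+ d)%:E)%E.
  move=> Xz0 s01 mS Sr Sg; have [_ L0 /(_ s S s01 Sr Sg)[N [w [Ns wS]]]] := rL z0 Xz0.
  have /andP[s0 _] := s01; set Lz := L z0 in L0 Ns wS.
  have Ls0 : 0 <= Lz * s by rewrite mulr_ge0// ltW.
  pose b : R := M1 * (2 * (Lz * s)) ^+ d * (M2 * (2 * (Lz * s)) ^+ d).
  have b0 : 0 <= b by rewrite !mulr_ge0// exprn_ge0// mulr_ge0.
  apply: (@le_trans _ _ (\sum_(f <- index_enum {ffun 'I_d -> 'I_N}) b)%:E).
    apply: (measure_le_cover (F := fun f => near_pair (Lz * s) (w f))) => //.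
    - by move=> f _; exact: measurable_near_pair.
    - move=> f _; rewrite near_pairE.
      rewrite [leLHS](_ : _ = mu1 (near_pt (Lz * s) (w f).1) * mu2 (near_pt (Lz * s) (w f).2))%E; last first.
        by apply: product_measure1E; exact: measurable_near_pt.
      by rewrite /b EFinM lee_pmul// ?mu1M ?mu2M.
    - by move=> z /wS[f fz]; exists f; rewrite ?mem_index_enum.
  rewrite lee_fin sumr_const card_ffun !card_ord -mulr_natl natrX.
  rewrite (_ : K z0 * s ^+ d =
      Lz ^+ d * (s ^+ d * (M1 * (2 * Lz) ^+ d * (M2 * (2 * Lz) ^+ d)))); last first.
    by rewrite /K -/Lz; ring.
  rewrite (_ : N%:R ^+ d * b =
      (N%:R * s) ^+ d * (s ^+ d * (M1 * (2 * Lz) ^+ d * (M2 * (2 * Lz) ^+ d)))); last first.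
    by rewrite /b !exprMn; ring.
  rewrite ler_wpM2r//; last by rewrite lerXn2r ?nnegrE ?mulr_ge0// ltW.
  by rewrite !mulr_ge0// ?exprn_ge0// ?mulr_ge0// ltW.
have cX := compact_finite_cover X_compact.
have [||D DX XD] := cX (V * V)%type X (fun z0 => (near_pair (r z0) z0)^°).
- by move=> z _; exact: open_interior.
- by move=> z Xz; exists z => //; apply: near_near_pair; have [] := rL z Xz.
have DX' z : z \in finmap.enum_fset D -> X z by move=> zD; have := DX z zD; rewrite inE.
exists (1 + \sum_(z <- finmap.enum_fset D) K z).
  rewrite ltr_pwDl// big_seq sumr_ge0// => z zD; exact/K0/DX'.
move=> s S s0 mS SX Sg.
(* The local covers are stated for [s <= 1] only; beyond, the summand 1 in the constant makes the
   trivial bound suffice. *)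
have [s1|s1] := leP s 1; last first.
  apply: (@le_trans _ _ 1%E); first exact: probability_le1.
  rewrite lee_fin mulr_ege1//; last by rewrite exprn_ege1// ltW.
  by rewrite lerDl big_seq sumr_ge0// => z zD; exact/K0/DX'.
apply: (@le_trans _ _ (\sum_(z <- finmap.enum_fset D) K z * s ^+ d)%:E).
  apply: (measure_le_cover (F := fun z0 => S `&` near_pair (r z0) z0)) => //.
  - by move=> z _; apply: measurableI => //; exact: measurable_near_pair.
  - move=> z /DX' Xz; apply: local => //; first by rewrite s0.
    + by apply: measurableI => //; exact: measurable_near_pair.
    + by move=> z' [].
    + by move=> z1 z2 [S1 _] [S2 _]; exact: Sg.
  - move=> z Sz; have [z0 zD /interior_subset rz] := XD z (SX z Sz).
    by exists z0.
rewrite -mulr_suml lee_fin ler_wpM2r ?exprn_ge0// ?(ltW s0)//.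
by rewrite lerDr.
Qed.

End gain_measure.
(** * Divergence and cost on finite partitions *)

(** Comparing positive and negative parts separately requires no integrability, which is not known
    for [f] of a density. *)
Lemma integral_le_measurable (d : measure_display) (T : measurableType d) (R : realType)
    (mu : {measure set T -> \bar R}) (f g : T -> \bar R) :
  measurable_fun setT f -> measurable_fun setT g -> (forall x, f x <= g x)%E ->
  (\int[mu]_x f x <= \int[mu]_x g x)%E.
Proof.
move=> mf mg fg; rewrite integralE [leRHS]integralE leeB//; apply: ge0_le_integral => //.
- exact: measurable_funepos.
- exact: measurable_funepos.
- by move=> x _; apply: (funepos_le (D := setT)); rewrite ?inE// => y _; exact: fg.
- exact: measurable_funeneg.
- exact: measurable_funeneg.
- by move=> x _; apply: (funeneg_le (D := setT)); rewrite ?inE// => y _; exact: fg.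
Qed.

Lemma probability_setI1 (d : measure_display) (T : measurableType d) (R : realType)
    (P : probability T R) (X A : set T) :
  measurable X -> measurable A -> P X = 1%E -> P (X `&` A) = P A.
Proof.
move=> mX mA PX; have mXA : measurable (X `&` A) by exact: measurableI.
have mXC : measurable (~` X) by exact: measurableC.
apply/eqP; rewrite eq_le; apply/andP; split; first by apply: le_measure; rewrite ?inE.
have PXC : P (~` X) = 0%E by rewrite probability_setC// PX subee.
rewrite -[leRHS]adde0 -PXC; apply: le_trans (measureU2 _ mXA mXC).
apply: le_measure; rewrite ?inE//; first exact: measurableU.
by move=> x Ax; have [Xx|nX] := pselect (X x); [left|right].
Qed.

Section finite_cells.
Context {d : measure_display} {T : measurableType d} {R : realType} {I : finType}.
Variable K : T -> I.
Hypothesis mK : forall i, measurable (K @^-1` [set i]).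

Lemma measurable_fun_cells (a : I -> R) : measurable_fun setT (a \o K).
Proof.
move=> _ Y mY; rewrite setTI.
rewrite (_ : _ @^-1` Y = \bigcup_(i in [set i | Y (a i)]) K @^-1` [set i]).
  by apply: fin_bigcup_measurable => [|i _]; [exact: finite_finset|exact: mK].
by apply/seteqP; split => [x Yx|x [i /= Yi xi]]; [by exists (K x)|rewrite /preimage /= xi].
Qed.

Lemma integral_cells (mu : {measure set T -> \bar R}) (X : set T) (f : T -> R) :
  measurable X -> measurable_fun X f ->
  (\int[mu]_(x in X) (f x)%:E =
   \sum_(i : I) \int[mu]_(x in X `&` K @^-1` [set i]) (f x)%:E)%E.
Proof.
move=> mX mf; have XE : \big[setU/set0]_(i <- index_enum I) (X `&` K @^-1` [set i]) = X.
  rewrite -bigcup_seq; apply/seteqP; split => [x [i _ []]//|x Xx].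
  by exists (K x) => //=; rewrite mem_index_enum.
rewrite -[in LHS]XE integral_bigsetU_EFin//.
- by move=> i; exact: measurableI.
- exact: index_enum_uniq.
- by move=> i j _ _ [x [[_ xi] [_ xj]]]; transitivity (K x).
- by rewrite XE; exact/measurable_EFinP.
Qed.

Lemma measure_cells (mu : {measure set T -> \bar R}) (Q : pred I) :
  (mu [set x | Q (K x)] = \sum_(i | Q i) mu (K @^-1` [set i]))%E.
Proof.
have uQ : uniq [seq i <- index_enum I | Q i] by rewrite filter_uniq// index_enum_uniq.
rewrite -big_filter fsbig_seq//.
rewrite -(measure_fin_bigcup mu)//; first congr (mu _).
- apply/seteqP; split => [x Qx|x [i /= + xi]];
  last by have <- : K x = i := xi; rewrite mem_filter => /andP[].
  by exists (K x) => //=; rewrite mem_filter Qx mem_index_enum.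
- by move=> i j _ _ [x [xi xj]]; transitivity (K x).
Qed.

Lemma f_divergence_cells (f G : R -> R) (y : I -> R) (pi P : probability T R) :
  measurable_fun setT f ->
  (forall x t, 0 <= t -> x * t - G t <= f x) -> (forall i, 0 <= y i) ->
  ((\sum_i (y i * fine (pi (K @^-1` [set i])) - G (y i) * fine (P (K @^-1` [set i]))))%:E
   <= f_divergence f pi P)%E.
Proof.
move=> mf young y0; rewrite /f_divergence; case: ifPn => [/asboolP piP|_]; last exact: leey.
set h := fun x => fine (Radon_Nikodym (charge_of_finite_measure pi) P x).
have hE x : (h x)%:E = Radon_Nikodym (charge_of_finite_measure pi) P x.
  by rewrite /h fineK// Radon_Nikodym_fin_num.
have ih : P.-integrable setT (EFin \o h).
  by rewrite (_ : _ \o _ = Radon_Nikodym (charge_of_finite_measure pi) P);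
    [exact: Radon_Nikodym_integrable|apply/funext => x; exact: hE].
have mh : measurable_fun setT h by apply/measurable_EFinP; exact: measurable_int ih.
pose g x := h x * y (K x) - G (y (K x)).
have mg : measurable_fun setT g.
  apply: measurable_funB; last exact: (measurable_fun_cells (G \o y)).
  by apply: measurable_funM => //; exact: measurable_fun_cells.
apply: (@le_trans _ _ (\int[P]_x (g x)%:E)%E); last first.
  apply: integral_le_measurable.
  - exact/measurable_EFinP.
  - by apply/measurable_EFinP; exact: measurableT_comp.
  - by move=> x; rewrite lee_fin; exact: young.
rewrite (integral_cells P measurableT mg) -sumEFin.
apply: lee_sum => i _; rewrite setTI; set A := K @^-1` [set i].
have mA : measurable A by exact: mK.
have ihA : P.-integrable A (EFin \o h) by apply: integrableS ih.
rewrite (eq_integral (fun x => (y i)%:E * (EFin \o h) x - (G (y i))%:E)%E); last first.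
  by move=> x; rewrite inE => -[<-]; rewrite /g EFinB EFinM muleC.
have iG : P.-integrable A (EFin \o cst (G (y i))).
  by apply: finite_measure_integrable_cst.
rewrite integralB//; last by exact: integrableZl.
rewrite integralZl// integral_cst//.
have -> : (\int[P]_(x in A) (EFin \o h) x = pi A)%E.
  under eq_integral do rewrite /= hE.
  by rewrite -(Radon_Nikodym_integral (nu := charge_of_finite_measure pi)).
by rewrite EFinB !EFinM !fineK ?fin_num_measure.
Qed.

Lemma integral_cells_bounds (pi : probability T R) (X : set T) (c : T -> R)
    (a : I -> R) (eta : R) : measurable X -> pi X = 1%E -> measurable_fun X c ->
  (forall x, X x -> `|c x - a (K x)| <= eta) ->
  (`|\int[pi]_(x in X) (c x)%:E - (\sum_i a i * fine (pi (K @^-1` [set i])))%:E| <= eta%:E)%E.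
Proof.
move=> mX piX mc cX.
have maK : measurable_fun X (a \o K) by apply: measurable_funS (measurable_fun_cells a).
pose M : R := eta + \sum_i `|a i|.
have aM i : `|a i| <= \sum_i `|a i| by rewrite (bigD1 i)//= lerDl sumr_ge0.
have iM : pi.-integrable X (EFin \o cst (\sum_i `|a i|)) by exact: finite_measure_integrable_cst.
have iM' : pi.-integrable X (EFin \o cst M) by exact: finite_measure_integrable_cst.
have iaK : pi.-integrable X (EFin \o (a \o K)).
  apply: le_integrable iM => //; first exact/measurable_EFinP.
  by move=> x _; rewrite /= lee_fin (le_trans (aM _))// ler_norm.
have ic : pi.-integrable X (EFin \o c).
  apply: le_integrable iM' => //; first exact/measurable_EFinP.
  move=> x Xx; rewrite /= lee_fin -[c x](subrK (a (K x))) (le_trans (ler_normD _ _))//.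
  by rewrite (le_trans _ (ler_norm _))// /M lerD// cX.
have -> : (\sum_i a i * fine (pi (K @^-1` [set i])))%:E = (\int[pi]_(x in X) (EFin \o (a \o K)) x)%E.
  rewrite [RHS](integral_cells pi mX maK) -sumEFin; apply: eq_bigr => i _.
  have mXi : measurable (X `&` K @^-1` [set i]) by exact: measurableI.
  rewrite (eq_integral (cst (a i)%:E)); last by move=> x; rewrite inE => -[_ /= <-].
  rewrite integral_cst// EFinM fineK ?fin_num_measure//; congr (_ * _)%E.
  exact/esym/(probability_setI1 mX (mK i) piX).
rewrite -integralB//.
have mcaK : measurable_fun X (fun x => (c x)%:E - (EFin \o (a \o K)) x)%E.
  by apply: emeasurable_funB; exact/measurable_EFinP.
apply: le_trans (le_abse_integral _ _ _) _ => //.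
apply: (@le_trans _ _ (\int[pi]_(x in X) cst eta%:E x)%E).
  by apply: ge0_le_integral => //; exact: measurableT_comp.
have E := integral_cst pi mX eta%:E.
by rewrite E [X in (_ * X <= _)%E](_ : _ = 1%E)// mule1.
Qed.

End finite_cells.

(** * Partitions on which the cost oscillates little *)

Lemma near_uniform_continuous (R : realType) (d : nat) (X : set ('rV[R]_d * 'rV[R]_d))
    (c : 'rV[R]_d * 'rV[R]_d -> R) (eta : R) :
  compact X -> (forall z, X z -> {for z, continuous c}) -> 0 < eta ->
  exists2 r : R, 0 < r & forall z z', X z -> X z' -> near_pair r z z' -> `|c z' - c z| <= eta.
Proof.
move=> cX cc eta0.
pose P (r : R) z := forall z', near_pair r z z' -> `|c z' - c z| <= eta.
have : near_covering X by exact/compact_near_coveringP.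
(* The radius is the filter parameter, so the local radii merge into a single one. *)
move=> /(_ R 0^'+ P _)[].
  move=> z Xz.
  have eta2 : 0 < eta / 2 by rewrite divr_gt0.
  have [r r0 rP] := nbhs_near_pair (near_dist_lt (cc z Xz) eta2).
  have r2 : 0 < r / 2 by rewrite divr_gt0.
  exists (near_pair (r / 2) z, [set t | t < r / 2]) => /=.
    by split; [exact: near_near_pair|exact: nbhs_right_lt].
  move=> [z' t] /= [[h1 h2] tr] z'' [g1 g2].
  have n1 : near_pair r z z'.
    by split=> i; [rewrite (lt_trans (h1 i))//|rewrite (lt_trans (h2 i))//]; lra.
  have n2 : near_pair r z z''.
    split=> i; [have := h1 i; have := g1 i|have := h2 i; have := g2 i]; rewrite !ltr_norml; lra.
  have := rP _ n1; have := rP _ n2; rewrite /= ltr_norml ler_norml ltr_norml; lra.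
move=> e /= e0 eP; exists (e / 2); first by rewrite divr_gt0.
move=> z z' Xz Xz'; apply: eP => //=; last by rewrite divr_gt0.
by rewrite sub0r normrN gtr0_norm ?divr_gt0// ltr_pdivrMr// ltr_pMr// ltr1n.
Qed.

Section finite_partition.
Context {R : realType} {d : nat}.
Local Notation V := 'rV[R]_d.

Lemma measurable_find_near (r : R) (s : seq V) (i : nat) :
  measurable [set x | find (fun p => `[< near_pt r p x >]) s = i].
Proof.
elim: s i => [|p s IH] [|i] /=.
- by rewrite (_ : [set _ | _] = setT)//; apply/seteqP.
- by rewrite (_ : [set _ | _] = set0)//; apply/seteqP; split.
- rewrite (_ : [set _ | _] = near_pt r p); first exact: measurable_near_pt.
  by apply/seteqP; split => x /=; case: asboolP.
- rewrite (_ : [set _ | _] = ~` near_pt r p `&`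
    [set x | find (fun p => `[< near_pt r p x >]) s = i]).
    by apply: measurableI => //; apply: measurableC; exact: measurable_near_pt.
  apply/seteqP; split => x /=; case: asboolP => // np; first by case.
    by case.
  by case=> _ ->.
Qed.

(** A point is assigned to the first centre within distance [r], which makes the cells disjoint. The
    last index collects the points close to no centre, all outside [X]; its centre defaults to [x0],
    so that every [p i] lies in [X]. *)
Lemma near_finite_partition (X : set V) (r : R) : X !=set0 -> compact X -> 0 < r ->
  exists n (k : V -> 'I_n.+1) (p : 'I_n.+1 -> V),
    [/\ forall i, measurable (k @^-1` [set i]), forall i, X (p i) &
        forall x, X x -> near_pt r (p (k x)) x].
Proof.
move=> [x0 Xx0] cX r0.
have [||D DX XD] := compact_finite_cover cX (D := X) (f := fun p => (near_pt r p)°).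
- by move=> i _; exact: open_interior.
- move=> x Xx; exists x => //; apply/nbhs_ballP; exists r => //= x' [_ h] i.
  by have := h ord0 i; rewrite -ball_normE /= distrC.
pose s : seq V := finmap.enum_fset D.
have sX p : p \in s -> X p by move=> pD; have := DX p pD; rewrite inE.
pose f x := find (fun p => `[< near_pt r p x >]) s.
have fs x : (f x < (size s).+1)%N by rewrite ltnS find_size.
exists (size s), (fun x => inord (f x)), (fun i => nth x0 s i); split.
- move=> i; rewrite (_ : _ @^-1` _ = [set x | f x = i]); first exact: measurable_find_near.
  by apply/seteqP; split => x /= fi; [rewrite -fi inordK|apply: val_inj; rewrite /= inordK].
- move=> i; have [si|si] := ltnP i (size s); first exact/sX/mem_nth.
  by rewrite nth_default.
- move=> x Xx; rewrite inordK//.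
  have hs : has (fun p => `[< near_pt r p x >]) s.
    have [p pD /interior_subset px] := XD x Xx.
    by apply/hasP; exists p => //; exact/asboolP.
  by have := nth_find x0 hs => /asboolP.
Qed.

End finite_partition.
(** * Couplings from discrete plans *)

Section plan_coupling.
Context {R : realType} {d1 d2 : measure_display} {T1 : measurableType d1} {T2 : measurableType d2}.
Variables (mu1 : probability T1 R) (mu2 : probability T2 R) (n m : nat).
Variables (k1 : T1 -> 'I_n.+1) (k2 : T2 -> 'I_m.+1).
Hypothesis mk1 : forall i, measurable (k1 @^-1` [set i]).
Hypothesis mk2 : forall j, measurable (k2 @^-1` [set j]).

Let a i := fine (mu1 (k1 @^-1` [set i])).
Let b j := fine (mu2 (k2 @^-1` [set j])).

Let a0 i : 0 <= a i. Proof. exact: fine_ge0. Qed.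
Let b0 j : 0 <= b j. Proof. exact: fine_ge0. Qed.

Let cell i j : set (T1 * T2) := (k1 @^-1` [set i]) `*` (k2 @^-1` [set j]).

Let mcell i j : measurable (cell i j).
Proof. exact: measurableX. Qed.

Lemma sum_cells d (T : measurableType d) (mu : probability T R) (l : nat) (k : T -> 'I_l.+1)
    (A : set T) : (forall i, measurable (k @^-1` [set i])) -> measurable A ->
  (\sum_i mu (A `&` k @^-1` [set i]) = mu A)%E.
Proof.
move=> mk mA; rewrite -measure_bigsetU_ord.
- congr (mu _); rewrite -bigcup_seq; apply/seteqP; split => [x [i _ []]//|x Ax].
  by exists (k x) => //=; rewrite mem_index_enum.
- by move=> i; exact: measurableI.
- by move=> i j _ _ [x [[_ xi] [_ xj]]]; transitivity (k x).
Qed.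

Lemma sum_fine_cells d (T : measurableType d) (mu : probability T R) (l : nat)
    (k : T -> 'I_l.+1) : (forall i, measurable (k @^-1` [set i])) ->
  \sum_i fine (mu (k @^-1` [set i])) = 1.
Proof.
move=> mk; apply: EFin_inj; rewrite -sumEFin -(probability_setT mu).
rewrite -(sum_cells mu mk measurableT).
by apply: eq_bigr => i _; rewrite setTI fineK// fin_num_measure.
Qed.

(** The coupling has density [p i j / (a i * b j)] on each cell with respect to the product measure.
    Inside a cell it is proportional to the product, so summing over a row or a column restores the
    original marginals and not just their cell masses. *)
Lemma plan_coupling (p : 'M[R]_(n.+1, m.+1)) :
  (forall i j, 0 <= p i j) -> (forall i, \sum_j p i j = a i) -> (forall j, \sum_i p i j = b j) ->
  exists2 pi, couplings mu1 mu2 pi & forall i j, pi (cell i j) = (p i j)%:E.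
Proof.
move=> p0 pa pb.
have w0 i j : 0 <= p i j / (a i * b j) by rewrite divr_ge0// mulr_ge0.
pose nu_ j i := mscale (NngNum (w0 (inord i) (inord j)))
  (mrestr (mu1 \x mu2)%E (mcell (inord i) (inord j))).
pose nu := msum (fun j => msum (nu_ j) n.+1) m.+1.
have nuE S : nu S = (\sum_i \sum_j (p i j / (a i * b j))%:E * (mu1 \x mu2) (S `&` cell i j))%E.
  rewrite /nu /msum /= exchange_big /=; apply: eq_bigr => i _; apply: eq_bigr => j _.
  by rewrite /nu_ /mscale /mrestr /= !inord_val.
(* On a massless cell the weight is a division by zero, that is 0; this default is harmless because
   the marginals force [p i j = 0] there. *)
have p_row i j : mu1 (k1 @^-1` [set i]) = 0%E -> p i j = 0.
  move=> mu0; apply/eqP; rewrite eq_le p0 andbT.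
  have <- : a i = 0 by rewrite /a mu0.
  by rewrite -pa (bigD1 j)//= lerDl sumr_ge0.
have p_col i j : mu2 (k2 @^-1` [set j]) = 0%E -> p i j = 0.
  move=> mu0; apply/eqP; rewrite eq_le p0 andbT.
  have <- : b j = 0 by rewrite /b mu0.
  by rewrite -pb (bigD1 i)//= lerDl sumr_ge0.
have aE i : (a i)%:E = mu1 (k1 @^-1` [set i]) by rewrite fineK// fin_num_measure.
have bE j : (b j)%:E = mu2 (k2 @^-1` [set j]) by rewrite fineK// fin_num_measure.
have nuX A B : measurable A -> measurable B ->
    nu (A `*` B) = (\sum_i \sum_j (p i j / (a i * b j))%:E *
      (mu1 (A `&` k1 @^-1` [set i]) * mu2 (B `&` k2 @^-1` [set j])))%E.
  move=> mA mB; rewrite nuE; apply: eq_bigr => i _; apply: eq_bigr => j _; congr (_ * _)%E.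
  by rewrite /cell -setXI; apply: product_measure1E; exact: measurableI.
have wab i j : ((p i j / (a i * b j))%:E * ((a i)%:E * (b j)%:E) = (p i j)%:E)%E.
  have [ai|ai] := eqVneq (a i) 0.
    by rewrite ai mul0r invr0 mulr0 mul0e p_row// -aE ai.
  have [bj|bj] := eqVneq (b j) 0.
    by rewrite bj mulr0 invr0 mulr0 mul0e p_col// -bE bj.
  by rewrite -!EFinM divfK// mulf_neq0.
have w1 i j r : p i j / (a i * b j) * (r * b j) = p i j / a i * r.
  have [bj|bj] := eqVneq (b j) 0; first by rewrite p_col -?bE ?bj// !mul0r.
  by rewrite invfM; move: (a i)^-1 => x; field.
have w2 i j r : p i j / (a i * b j) * (a i * r) = p i j / b j * r.
  have [ai|ai] := eqVneq (a i) 0; first by rewrite p_row -?aE ?ai// !mul0r.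
  by rewrite invfM; move: (b j)^-1 => x; field.
have fstE A : measurable A -> nu (A `*` setT) = mu1 A.
  move=> mA; rewrite nuX// -[RHS](sum_cells mu1 mk1 mA); apply: eq_bigr => i _.
  have mAi : measurable (A `&` k1 @^-1` [set i]) by exact: measurableI.
  have [r rE] : exists r, mu1 (A `&` k1 @^-1` [set i]) = r%:E.
    by exists (fine (mu1 (A `&` k1 @^-1` [set i]))); rewrite fineK// fin_num_measure.
  have rai : a i = 0 -> r = 0.
    move=> ai; apply/eqP; rewrite eq_le -!lee_fin -rE measure_ge0 andbT -ai aE.
    by apply: le_measure; rewrite ?inE//; exact: subIsetr.
  rewrite rE (eq_bigr (fun j => (p i j / a i * r)%:E)) => [|j _].
    rewrite sumEFin -!mulr_suml pa; have [ai|ai] := eqVneq (a i) 0.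
      by rewrite rai// mulr0.
    by rewrite divff// mul1r.
  by rewrite setTI -bE -!EFinM w1.
have sndE B : measurable B -> nu (setT `*` B) = mu2 B.
  move=> mB; rewrite nuX// -[RHS](sum_cells mu2 mk2 mB) exchange_big; apply: eq_bigr => j _.
  have mBj : measurable (B `&` k2 @^-1` [set j]) by exact: measurableI.
  have [r rE] : exists r, mu2 (B `&` k2 @^-1` [set j]) = r%:E.
    by exists (fine (mu2 (B `&` k2 @^-1` [set j]))); rewrite fineK// fin_num_measure.
  have rbj : b j = 0 -> r = 0.
    move=> bj; apply/eqP; rewrite eq_le -!lee_fin -rE measure_ge0 andbT -bj bE.
    by apply: le_measure; rewrite ?inE//; exact: subIsetr.
  rewrite rE (eq_bigr (fun i => (p i j / b j * r)%:E)) => [|i _].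
    rewrite sumEFin -!mulr_suml pb; have [bj|bj] := eqVneq (b j) 0.
      by rewrite rbj// mulr0.
    by rewrite divff// mul1r.
  by rewrite setTI -aE -!EFinM w2.
have nuT : nu setT = 1%E by rewrite -setXTT fstE// probability_setT.
pose pi : probability (T1 * T2)%type R :=
  HB.pack_for (probability (T1 * T2)%type R) nu (Measure_isProbability.Build _ _ _ nu nuT).
exists pi.
  by split => A mA; [rewrite -setXT; exact: fstE|rewrite -setTX; exact: sndE].
move=> i j; transitivity (nu (cell i j)) => //.
rewrite nuE (bigD1 i)//= (bigD1 j)//= setIid.
rewrite [X in (X + _ + _)%E](_ : _ = (p i j)%:E); last first.
  rewrite -wab aE bE; congr (_ * _)%E; exact: product_measure1E.
have cell0 i' j' : (i', j') != (i, j) -> (mu1 \x mu2)%E (cell i j `&` cell i' j') = 0%E.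
  move=> /eqP ij; rewrite (_ : cell i j `&` cell i' j' = set0) ?measure0//.
  apply/seteqP; split => // z [[/= zi zj] [/= zi' zj']]; apply: ij.
  by rewrite -zi -zj -zi' -zj'.
rewrite big1 ?adde0 => [|l lj]; last by rewrite cell0 ?mule0// xpair_eqE negb_and lj orbT.
rewrite big1 ?adde0// => k ki; rewrite big1// => l _.
by rewrite cell0 ?mule0// xpair_eqE negb_and ki.
Qed.

End plan_coupling.

(** * Couplings seen on pairs of cells *)

Lemma compact_measurable_rV (R : realType) (d : nat) (X : set 'rV[R]_d) :
  compact X -> measurable X.
Proof.
move=> cX; have clX : closed X by apply: compact_closed => //; exact: norm_hausdorff.
by rewrite -[X]setCK; apply: measurableC; apply: open_measurable_rV; exact: closed_openC.
Qed.

Section cell_pairs.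
Context {R : realType} {d1 d2 : measure_display} {T1 : measurableType d1} {T2 : measurableType d2}.
Context {n m : nat}.
Variables (k1 : T1 -> 'I_n.+1) (k2 : T2 -> 'I_m.+1).
Hypothesis mk1 : forall i, measurable (k1 @^-1` [set i]).
Hypothesis mk2 : forall j, measurable (k2 @^-1` [set j]).

Definition cell_pair (z : T1 * T2) := (k1 z.1, k2 z.2).

Lemma cell_pairE ij : cell_pair @^-1` [set ij] = (k1 @^-1` [set ij.1]) `*` (k2 @^-1` [set ij.2]).
Proof.
by case: ij => i j; apply/seteqP; split => z /=; rewrite /cell_pair => -[-> ->].
Qed.

Lemma measurable_cell_pair ij : measurable (cell_pair @^-1` [set ij]).
Proof. by rewrite cell_pairE; exact: measurableX. Qed.

Lemma measurable_cell_pairs (Q : pred ('I_n.+1 * 'I_m.+1)) :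
  measurable [set z | Q (cell_pair z)].
Proof.
have := measurable_fun_cells measurable_cell_pair (fun ij => (Q ij)%:R : R).
move=> /(_ measurableT [set 1] (measurable_set1 _)); rewrite setTI.
congr measurable; apply/seteqP; split => z /=; case: (Q _) => //=.
by move=> /eqP; rewrite eq_sym oner_eq0.
Qed.

Lemma coupling_marginals (mu1 : probability T1 R) (mu2 : probability T2 R)
    (pi : probability (T1 * T2)%type R) :
  couplings mu1 mu2 pi ->
  (forall i, \sum_j fine (pi (cell_pair @^-1` [set (i, j)])) = fine (mu1 (k1 @^-1` [set i]))) /\
  (forall j, \sum_i fine (pi (cell_pair @^-1` [set (i, j)])) = fine (mu2 (k2 @^-1` [set j]))).
Proof.
move=> [pi1 pi2].
have m1 i : measurable (fst @^-1` (k1 @^-1` [set i]) : set (T1 * T2)).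
  by rewrite -[X in measurable X]setTI; exact: measurable_fst.
have m2 j : measurable (snd @^-1` (k2 @^-1` [set j]) : set (T1 * T2)).
  by rewrite -[X in measurable X]setTI; exact: measurable_snd.
have fs (F : set (T1 * T2)) : measurable F -> ((fine (pi F))%:E = pi F)%E.
  by move=> mF; rewrite fineK// fin_num_measure.
split => [i|j].
  apply: EFin_inj; rewrite fineK ?fin_num_measure// -pi1// -sumEFin.
  rewrite -[RHS](sum_cells (k := k2 \o snd) pi m2 (m1 i)); apply: eq_bigr => j _.
  by rewrite fs; [rewrite cell_pairE|exact: measurable_cell_pair].
apply: EFin_inj; rewrite fineK ?fin_num_measure// -pi2// -sumEFin.
rewrite -[RHS](sum_cells (k := k1 \o fst) pi m1 (m2 j)); apply: eq_bigr => i _.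
by rewrite fs; [rewrite cell_pairE setIC|exact: measurable_cell_pair].
Qed.

End cell_pairs.

Lemma coupling_carrier (R : realType) (d1 d2 : measure_display) (T1 : measurableType d1)
    (T2 : measurableType d2) (mu1 : probability T1 R) (mu2 : probability T2 R)
    (X1 : set T1) (X2 : set T2)
    (pi : probability (T1 * T2)%type R) :
  measurable X1 -> measurable X2 -> mu1 X1 = 1%E -> mu2 X2 = 1%E ->
  couplings mu1 mu2 pi -> pi (X1 `*` X2) = 1%E.
Proof.
move=> mX1 mX2 mu1X mu2X [pi1 pi2].
have mX1C : measurable (fst @^-1` (~` X1) : set (T1 * T2)).
  by rewrite -[X in measurable X]setTI; exact: (measurable_fst measurableT _ (measurableC mX1)).
have mX2C : measurable (snd @^-1` (~` X2) : set (T1 * T2)).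
  by rewrite -[X in measurable X]setTI; exact: (measurable_snd measurableT _ (measurableC mX2)).
have mX : measurable (X1 `*` X2) by exact: measurableX.
have piC : pi (~` (X1 `*` X2)) = 0%E.
  apply/eqP; rewrite eq_le measure_ge0 andbT.
  apply: (@le_trans _ _ (pi (fst @^-1` (~` X1)) + pi (snd @^-1` (~` X2)))%E).
    rewrite (le_trans _ (measureU2 _ mX1C mX2C))//; apply: le_measure; rewrite ?inE.
    - exact: measurableC.
    - exact: measurableU.
    - by move=> z nX; have [z1|] := pselect (X1 z.1); [right => z2; exact: nX|left].
  by rewrite pi1 ?pi2; do ?exact: measurableC; rewrite !probability_setC// mu1X mu2X subee// adde0.
by have := probability_setC pi (measurableC mX); rewrite setCK piC sube0.
Qed.
(** * The discretized lower bound *)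

Section discretization.
Context {R : realType} {d : nat}.
Local Notation V := 'rV[R]_d.
Variables (X1 X2 : set V) (mu1 mu2 : probability V R) (c : V * V -> R).
Hypotheses (X1_compact : compact X1) (X2_compact : compact X2).
Hypotheses (mu1_X1 : mu1 X1 = 1%E) (mu2_X2 : mu2 X2 = 1%E).
Hypotheses (mu1_density : bounded_density mu1) (mu2_density : bounded_density mu2).
Hypotheses (c_C2 : C2_near (X1 `*` X2) c) (c_nondegenerate : nondegenerate_cost (X1 `*` X2) c).

Let X := X1 `*` X2.

Let carrier_nonempty (mu : probability V R) (Y : set V) : mu Y = 1%E -> Y !=set0.
Proof.
by move=> muY; apply/set0P/eqP => Y0;
  move: muY; rewrite Y0 measure0 => /eqP; rewrite eqe eq_sym oner_eq0.
Qed.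

Lemma cost_partition (eta : R) : 0 < eta ->
  exists n m (k1 : V -> 'I_n.+1) (k2 : V -> 'I_m.+1) (a : 'I_n.+1 * 'I_m.+1 -> R),
    [/\ forall i, measurable (k1 @^-1` [set i]), forall j, measurable (k2 @^-1` [set j]) &
        forall z, X z -> `|c z - a (cell_pair k1 k2 z)| <= eta].
Proof.
move=> eta0; have [U [oU XU cC2]] := c_C2.
have cX : compact X by exact: compact_setX.
have [r r0 rP] := near_uniform_continuous cX (fun z Xz => C2_continuous oU cC2 (XU z Xz)) eta0.
have [n [k1 [p1 [mk1 Xp1 kp1]]]] := near_finite_partition (carrier_nonempty mu1_X1) X1_compact r0.
have [m [k2 [p2 [mk2 Xp2 kp2]]]] := near_finite_partition (carrier_nonempty mu2_X2) X2_compact r0.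
exists n, m, k1, k2, (fun ij => c (p1 ij.1, p2 ij.2)); split => // z [X1z X2z].
by apply: rP; [split; [exact: Xp1|exact: Xp2]|split|split; [exact: kp1|exact: kp2]].
Qed.

Let mX : measurable X.
Proof. by apply: measurableX; exact: compact_measurable_rV. Qed.

(** [c] is controlled only near [X], so measurability on [X] is obtained from a uniform limit of
    functions constant on cells. *)
Lemma measurable_cost : measurable_fun X c.
Proof.
have /choice[h hP] : forall l : nat, exists h : V * V -> R, measurable_fun setT h /\
    forall z, X z -> `|c z - h z| <= l.+1%:R^-1.
  move=> l; have [|n [m [k1 [k2 [a [mk1 mk2 ca]]]]]] := @cost_partition l.+1%:R^-1.
    by rewrite invr_gt0.
  exists (a \o cell_pair k1 k2); split => //.
  by apply: measurable_fun_cells; exact: measurable_cell_pair.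
apply: (measurable_fun_cvg (h := h)) => [l|z Xz].
  by apply: measurable_funS (hP l).1.
apply/cvgrPdist_le => e e0; have [N _ NP] := near_infty_natSinv_lt (PosNum e0).
exists N => // l Nl; rewrite (le_trans ((hP l).2 z Xz))// ltW//.
exact: NP.
Qed.

(** Makes [OT] a real number, hence the difference with [OT_div] meaningful: the cost is bounded on
    [X], and the product plan shows that couplings exist. *)
Lemma OT_fin_num : OT X c mu1 mu2 \is a fin_num.
Proof.
have [n [m [k1 [k2 [a [mk1 mk2 ca]]]]]] := cost_partition ltr01.
pose p : 'M[R]_(n.+1, m.+1) := \matrix_(i, j)
  (fine (mu1 (k1 @^-1` [set i])) * fine (mu2 (k2 @^-1` [set j]))).
have [pi0 cpi0 _] : exists2 pi, couplings mu1 mu2 pi &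
    forall i j, pi ((k1 @^-1` [set i]) `*` (k2 @^-1` [set j])) = (p i j)%:E.
  apply: plan_coupling => // [i j|i|j].
  - by rewrite mxE mulr_ge0// fine_ge0.
  - by under eq_bigr do rewrite mxE; rewrite -mulr_sumr sum_fine_cells// mulr1.
  - by under eq_bigr do rewrite mxE; rewrite -mulr_suml sum_fine_cells// mul1r.
pose B := 1 + \sum_ij `|a ij|.
have bnd pi : couplings mu1 mu2 pi -> ((- B)%:E <= \int[pi]_(z in X) (c z)%:E <= B%:E)%E.
  move=> cpi; have piX := coupling_carrier (compact_measurable_rV X1_compact)
    (compact_measurable_rV X2_compact) mu1_X1 mu2_X2 cpi.
  have := integral_cells_bounds (measurable_cell_pair mk1 mk2) mX piX measurable_cost ca.
  set s := \sum_i _; set I := integral _ _ _ => Is.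
  have sle : `|s| <= \sum_ij `|a ij|.
    rewrite (le_trans (ler_norm_sum _ _ _))// ler_sum// => ij _.
    rewrite normrM ler_piMr// ger0_norm ?fine_ge0// -lee_fin fineK ?fin_num_measure//; last first.
      exact: measurable_cell_pair.
    by apply: probability_le1; exact: measurable_cell_pair.
  case: I Is => [I| |]//=; rewrite -?EFinB ?lee_fin// -ler_norml => Is.
  rewrite -[I](subrK s) (le_trans (ler_normD _ _))// lerD//.
rewrite fin_real//; apply/andP; split.
  rewrite (@lt_le_trans _ _ (- B)%:E)// ?ltNyr//.
  apply: le_ereal_inf_tmp => _ [pi cpi <-].
  by have /andP[] := bnd pi cpi.
apply: le_lt_trans (ereal_inf_lbound _) _; first by exists pi0; [exact: cpi0|].
by have /andP[_ /le_lt_trans] := bnd pi0 cpi0; apply; rewrite ltry.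
Qed.

(* On a partition into cells, e is the reduced cost (c - u - v) / eps of a dual
   solution (u, v) and w the mass of the cells under mu1 \x mu2. *)
Lemma discretized_gap_bound : exists2 C : R, 0 < C & forall eps : R, 0 < eps ->
  exists n m (e w : 'I_n.+1 * 'I_m.+1 -> R),
    [/\ forall ij, 0 <= e ij, forall ij, 0 <= w ij, \sum_ij w ij = 1,
        forall t, 1 <= t -> \sum_(ij | e ij <= t) w ij <= C * Num.sqrt (t * eps) ^+ d &
        forall (f G : R -> R), measurable_fun setT f ->
          (forall x t, 0 <= t -> x * t - G t <= f x) -> forall lam, 0 <= lam ->
          ((eps * (lam - 1 - \sum_ij w ij * G (Num.max 0 (lam - e ij))))%:E
            <= OT_div f eps X c mu1 mu2 - OT X c mu1 mu2)%E].
Proof.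
have [C C0 CP] := small_gain_measure mu1_density mu2_density
  (compact_setX X1_compact X2_compact) c_C2 c_nondegenerate.
(* With a quarter of [eps], both the four evaluations of [c] in a cross difference and the three
   errors [eta] in the final lower bound stay within [eps]. *)
exists C => // eps eps0; pose eta := eps / 4.
have eta0 : 0 < eta by rewrite divr_gt0.
have [n [m [k1 [k2 [a [mk1 mk2 ca]]]]]] := cost_partition eta0.
have mk := measurable_cell_pair mk1 mk2.
pose cell ij := cell_pair k1 k2 @^-1` [set ij].
pose b1 i := fine (mu1 (k1 @^-1` [set i])); pose b2 j := fine (mu2 (k2 @^-1` [set j])).
have b10 i : 0 <= b1 i by exact: fine_ge0.
have b20 j : 0 <= b2 j by exact: fine_ge0.
have OTfin := OT_fin_num; pose v := fine (OT X c mu1 mu2).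
have vE : (v%:E = OT X c mu1 mu2)%E by rewrite /v fineK.
have approx pi : couplings mu1 mu2 pi -> exists I : R,
    (\int[pi]_(z in X) (c z)%:E = I%:E)%E /\ `|I - \sum_ij a ij * fine (pi (cell ij))| <= eta.
  move=> cpi; have piX := coupling_carrier (compact_measurable_rV X1_compact)
    (compact_measurable_rV X2_compact) mu1_X1 mu2_X2 cpi.
  have := integral_cells_bounds mk mX piX measurable_cost ca.
  by case: (integral _ _ _) => [I| |]//=; rewrite -?EFinB ?lee_fin// => Is; exists I.
(* One [eta] is the error of the cell costs; the second makes the inequality strict, as
   [finite_kantorovich] requires. *)
have [u [w [uw uwv]]] : exists u w, (forall i j, u i + w j <= a (i, j)) /\
    v - 2 * eta <= \sum_i u i * b1 i + \sum_j w j * b2 j.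
  apply: finite_kantorovich; rewrite ?sum_fine_cells// => p p0 pb1 pb2.
  have [pi cpi piE] := plan_coupling mk1 mk2 p0 pb1 pb2.
  have [I [IE Ia]] := approx pi cpi.
  have vI : v <= I.
    by rewrite -lee_fin vE -IE; apply: ereal_inf_lbound; exists pi.
  have : \sum_ij a ij * fine (pi (cell ij)) = plan_cost (fun i j => a (i, j)) p.
    rewrite /plan_cost pair_big; apply: eq_bigr => -[i j] _ /=.
    by rewrite /cell cell_pairE piE.
  by move: Ia; rewrite ler_norml; lra.
pose e ij := (a ij - u ij.1 - w ij.2) / eps.
pose P : probability (V * V)%type R := (mu1 \x mu2)%E.
pose W ij := fine (P (cell ij)).
have e0 ij : 0 <= e ij.
  by case: ij => i j; rewrite divr_ge0 ?(ltW eps0)//=; have := uw i j; lra.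
have W0 ij : 0 <= W ij by exact: fine_ge0.
have WE ij : (W ij)%:E = P (cell ij) by rewrite fineK// fin_num_measure//; exact: mk.
have cP : couplings mu1 mu2 P.
  split=> A mA; rewrite /P /=.
    rewrite -setXT; transitivity (mu1 A * mu2 setT)%E; first exact: product_measure1E.
    by rewrite probability_setT mule1.
  rewrite -setTX; transitivity (mu1 setT * mu2 A)%E; first exact: product_measure1E.
  by rewrite probability_setT mul1e.
exists n, m, e, W; split => //.
- apply: EFin_inj; rewrite -sumEFin -(probability_setT P).
  rewrite (_ : setT = [set z | predT (cell_pair k1 k2 z)]); last exact/seteqP.
  by rewrite (measure_cells mk P predT); apply: eq_bigr => ij _; exact: WE.
- move=> t t1; rewrite -lee_fin.
  pose S := X `&` [set z | e (cell_pair k1 k2 z) <= t].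
  have mS : measurable S.
    apply: measurableI => //.
    exact: (measurable_cell_pairs mk1 mk2 (fun ij => e ij <= t)).
  have -> : (\sum_(ij | e ij <= t) W ij)%:E = P S.
    rewrite -sumEFin (eq_bigr (fun ij => P (cell ij))) => [|ij _]; last exact: WE.
    rewrite -(measure_cells mk P (fun ij => e ij <= t)).
    have PX := coupling_carrier (compact_measurable_rV X1_compact)
      (compact_measurable_rV X2_compact) mu1_X1 mu2_X2 cP.
    by rewrite /S probability_setI1//; exact: (measurable_cell_pairs mk1 mk2 (fun ij => e ij <= t)).
  have t0 : 0 < t * eps by rewrite mulr_gt0// (lt_le_trans _ t1).
  apply: CP => //; rewrite ?sqrtr_gt0//; first by move=> z [].
  move=> z z' [Xz ez] [Xz' ez']; rewrite sqr_sqrtr ?(ltW t0)//.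
  have [z1 z2] := Xz; have [z1' z2'] := Xz'.
  have := ca z Xz; have := ca z' Xz'.
  have := ca (z.1, z'.2) (conj z1 z2'); have := ca (z'.1, z.2) (conj z1' z2).
  move: ez ez'; rewrite /= /cell_pair /= !ler_pdivrMr//=.
  have := uw (k1 z.1) (k2 z'.2); have := uw (k1 z'.1) (k2 z.2).
  rewrite /cross_difference /eta !ler_norml.
  (* The dual inequalities give 2 t eps plus an error of at most eps; as [t >= 1], the sum is below
     4 t eps. *)
  have : eps <= t * eps by rewrite ler_peMl// ltW.
  lra.
- move=> f G mf young lam lam0; rewrite leeBrDr// -vE -EFinD.
  apply: le_ereal_inf_tmp => _ [pi cpi <-].
  have [I [-> Ia]] := approx pi cpi.
  (* The least nonnegative [y] with [y + e >= lam]: averaged over any coupling, [y] and [e] together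
     give at least [lam]. *)
  pose y ij := Num.max 0 (lam - e ij).
  have y0 ij : 0 <= y ij by rewrite le_max lexx.
  have := f_divergence_cells mk pi P mf young y0.
  have epsE : (0 <= eps%:E)%E by rewrite lee_fin ltW.
  move=> /(lee_wpmul2l epsE)/(leeD2l I%:E); apply: le_trans; rewrite -EFinM -EFinD lee_fin.
  have [m1 m2] := coupling_marginals mk1 mk2 cpi.
  pose q ij := fine (pi (cell ij)).
  have q0 ij : 0 <= q ij by exact: fine_ge0.
  have q1 : \sum_ij q ij = 1.
    rewrite -(sum_fine_cells mu1 mk1) -(eq_bigr _ (fun i _ => m1 i)) pair_big.
    by apply: eq_bigr => -[].
  have aE : \sum_ij a ij * q ij =
      \sum_i u i * b1 i + \sum_j w j * b2 j + eps * \sum_ij e ij * q ij.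
    have -> : \sum_i u i * b1 i = \sum_ij u ij.1 * q ij.
      rewrite (eq_bigr (fun i => \sum_j u i * q (i, j))) => [|i _]; last first.
        by rewrite /b1 -m1 mulr_sumr.
      by rewrite pair_big; apply: eq_bigr => -[].
    have -> : \sum_j w j * b2 j = \sum_ij w ij.2 * q ij.
      rewrite (eq_bigr (fun j => \sum_i w j * q (i, j))) => [|j _]; last first.
        by rewrite /b2 -m2 mulr_sumr.
      by rewrite exchange_big pair_big; apply: eq_bigr => -[].
    rewrite mulr_sumr -!big_split; apply: eq_bigr => ij _ /=.
    by rewrite /e; field; rewrite gt_eqF.
  have yE : lam - \sum_ij e ij * q ij <= \sum_ij y ij * q ij.
    rewrite -[lam]mulr1 -q1 mulr_sumr -sumrB ler_sum// => ij _.
    by rewrite -mulrBl ler_wpM2r// le_max lexx orbT.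
  set SG := \sum_ij W ij * G (y ij).
  have -> : \sum_i (y i * fine (pi (cell_pair k1 k2 @^-1` [set i])) -
      G (y i) * fine (P (cell_pair k1 k2 @^-1` [set i]))) = \sum_ij y ij * q ij - SG.
    by rewrite sumrB; congr (_ - _); apply: eq_bigr => ij _; rewrite mulrC.
  have := ler_wpM2l (ltW eps0) yE; rewrite mulrBr => yE'.
  move: Ia; rewrite -/q aE ler_norml /eta => Ia.
  have := uwv; rewrite /eta; lra.
Qed.

End discretization.
(** * Rates *)

Section young.
Context {R : realType}.

(** For positive [x] this is 1 + s <= exp(s) at s = t - 1 - ln x. For [x <= 0] the convention on
    [ln] gives [xlnx x = 0]; covering all real [x] avoids discussing the sign of the density. *)
Lemma xlnx_young (x t : R) : 0 <= t -> x * t - expR (t - 1) <= xlnx x.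
Proof.
move=> t0; rewrite /xlnx; have [x0|x0] := leP x 0.
  rewrite ln0// mulr0; have := expR_ge0 (t - 1); have : x * t <= 0 by rewrite mulr_le0_ge0.
  lra.
have -> : expR (t - 1) = x * expR (t - 1 - ln x).
  by rewrite expRB lnK ?posrE// mulrCA divff ?mulr1 ?gt_eqF.
have : x * (1 + (t - 1 - ln x)) <= x * expR (t - 1 - ln x) by rewrite ler_pM2l// expR_ge1Dx.
lra.
Qed.

Lemma measurable_xlnx : measurable_fun setT (@xlnx R).
Proof. by apply: measurable_funM => //; exact: measurable_ln. Qed.

(** [(rho - 1)^-1 + 1] is the exponent conjugate to [rho], and the summand [rho^-1] accounts for the
    -1 in [power_div]. *)
Lemma power_div_young (rho x t : R) : 1 < rho -> 0 <= t ->
  x * t - (t `^ ((rho - 1)^-1 + 1) / ((rho - 1)^-1 + 1) + rho^-1) <= power_div rho x.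
Proof.
move=> rho1 t0; have r0 : 0 < (rho - 1)^-1 by rewrite invr_gt0 subr_gt0.
have rho0 : 0 < rho by lra.
rewrite /power_div mulrBr mulr1; have [x0|x0] := leP 0 x.
  have := @conjugate_powR R x t rho ((rho - 1)^-1 + 1) x0 t0 rho0.
  have -> : rho^-1 + ((rho - 1)^-1 + 1)^-1 = 1.
    by field; rewrite ?gt_eqF//; lra.
  move=> /(_ ltac:(lra) erefl); lra.
have : x * t <= 0 by rewrite nmulr_rle0.
have : 0 <= rho^-1 * x `^ rho by rewrite mulr_ge0 ?powR_ge0// invr_ge0 ltW.
have : 0 <= t `^ ((rho - 1)^-1 + 1) / ((rho - 1)^-1 + 1) by rewrite divr_ge0 ?powR_ge0//; lra.
lra.
Qed.

Lemma measurable_power_div rho : measurable_fun setT (@power_div R rho).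
Proof.
apply: measurable_funM => //; apply: measurable_funB => //; exact: measurable_powR.
Qed.

(** A layer-cake bound: for s between k and k+1 the exponential is at most exp(lam - k). The
    thresholds [k.+1] are all at least 1, where the sublevel estimate is available; the leading 1
    covers [lam <= s]. *)
Lemma expR_layers (lam s : R) (n : nat) : 0 <= s -> lam <= n%:R ->
  expR (Num.max 0 (lam - s) - 1) <=
    1 + \sum_(k < n) expR (lam - k%:R) * (s <= k.+1%:R)%R%:R.
Proof.
move=> s0 lamn; have sum0 (A : pred 'I_n) :
    0 <= \sum_(k < n | A k) expR (lam - k%:R) * (s <= k.+1%:R)%R%:R.
  by rewrite sumr_ge0// => k _; rewrite mulr_ge0 ?expR_ge0.
have [ls|ls] := leP (lam - s) 0.
  apply: (@le_trans _ _ 1); last by rewrite lerDl sum0.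
  by rewrite -[leRHS]expR0 ler_expR; lra.
have /andP[ks sk] := truncn_itv s0; set k := Num.truncn s in ks sk.
have kn : (k < n)%N by rewrite -(ltr_nat R); lra.
rewrite (bigD1 (Ordinal kn))//= (ltW sk) mulr1 addrCA.
apply: (@le_trans _ _ (expR (lam - k%:R))); first by rewrite ler_expR; lra.
by rewrite lerDl addr_ge0 ?sum0.
Qed.

(** Since k+1 <= 2d exp((k+1)/(2d)), the power costs only half of the exponential decay, and a
    geometric series of ratio exp(-1/2) remains. *)
Lemma sum_expRN_exp_le (d n : nat) : (0 < d)%N ->
  \sum_(k < n) expR (- k%:R) * k.+1%:R ^+ d <=
    (2 * d%:R) ^+ d * expR 2^-1 / (1 - expR (- 2^-1)) :> R.
Proof.
move=> d0; set q := expR (- 2^-1).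
have q1 : q < 1 by rewrite -[ltRHS]expR0 ltr_expR; lra.
have dR : 0 < d%:R :> R by rewrite ltr0n.
have geom : \sum_(k < n) q ^+ k <= (1 - q)^-1.
  rewrite -[leRHS]mul1r ler_pdivlMr ?subr_gt0//.
  have := subrX1 q n; have : 0 <= q ^+ n by rewrite exprn_ge0// expR_ge0.
  rewrite mulrC; nra.
have term k : expR (- k%:R) * k.+1%:R ^+ d <= (2 * d%:R) ^+ d * expR 2^-1 * q ^+ k :> R.
  have kd : k.+1%:R ^+ d <= (2 * d%:R) ^+ d * expR (k.+1%:R / 2) :> R.
    have -> : expR (k.+1%:R / 2 : R) = expR (k.+1%:R / (2 * d%:R)) ^+ d.
      by rewrite -expRM_natl; congr expR; field; rewrite gt_eqF.
    rewrite -exprMn lerXn2r ?nnegrE// ?mulr_ge0 ?expR_ge0//.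
    rewrite -ler_pdivrMl ?mulr_gt0// mulrC.
    by apply: le_trans (expR_ge1Dx _); rewrite lerDr.
  apply: le_trans (ler_wpM2l (expR_ge0 _) kd) _.
  rewrite mulrCA -mulrA ler_wpM2l ?exprn_ge0 ?mulr_ge0//.
  by rewrite /q -expRM_natl -!expRD ler_expR -natr1; lra.
apply: le_trans (ler_sum _ (fun (k : 'I_n) _ => term k)) _.
by rewrite -mulr_sumr ler_wpM2l// mulr_ge0 ?expR_ge0// exprn_ge0// mulr_ge0.
Qed.

End young.

(** * Choice of the multiplier lam and the resulting rates *)

Section rates.
Context {R : realType} {d : nat}.
Variables (C : R) (gap : (R -> R) -> R -> \bar R).
Hypotheses (d_gt0 : (0 < d)%N) (C0 : 0 < C).
Hypothesis gapP : forall eps : R, 0 < eps ->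
  exists n m (e w : 'I_n.+1 * 'I_m.+1 -> R),
    [/\ forall ij, 0 <= e ij, forall ij, 0 <= w ij, \sum_ij w ij = 1,
        forall t, 1 <= t -> \sum_(ij | e ij <= t) w ij <= C * Num.sqrt (t * eps) ^+ d &
        forall (f G : R -> R), measurable_fun setT f ->
          (forall x t, 0 <= t -> x * t - G t <= f x) -> forall lam, 0 <= lam ->
          ((eps * (lam - 1 - \sum_ij w ij * G (Num.max 0 (lam - e ij))))%:E <= gap f eps)%E].

(** [lam] is chosen so that exp(lam) times the d-th power of sqrt(eps) is 1. Layer k then
    contributes at most C exp(-k) (k+1)^d, which is summable uniformly in [eps]. *)
Lemma entropic_gap_lower_bound :
  ge_upto_bigO (gap xlnx) (fun eps => d%:R / 2 * eps * ln (eps^-1)).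
Proof.
pose B : R := (2 * d%:R) ^+ d * expR 2^-1 / (1 - expR (- 2^-1)).
(* One unit is the discretization loss, the other the constant term of [expR_layers]. *)
exists (2 + C * B); near=> eps.
have eps0 : 0 < eps by [].
have eps1 : eps < 1 by near: eps; exact: nbhs_right_lt.
have [n [m [e [w [e0 w0 w1 wt bound]]]]] := gapP eps0.
pose lam : R := d%:R / 2 * ln (eps^-1).
have lam0 : 0 <= lam.
  by rewrite mulr_ge0 ?divr_ge0// ln_ge0// invf_ge1// ltW.
have sqrt_eps : Num.sqrt eps ^+ d = expR (- lam).
  have -> : Num.sqrt eps = expR (ln eps / 2).
    apply/eqP; rewrite -(@eqrXn2 _ 2)// ?sqrtr_ge0 ?expR_ge0//.
    rewrite sqr_sqrtr ?ltW// -expRM_natl mulrC divfK// lnK// posrE//.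
  by rewrite -expRM_natl; congr expR; rewrite /lam lnV ?posrE//; ring.
have layers k : \sum_ij w ij * (expR (lam - k%:R) * (e ij <= k.+1%:R)%R%:R) <=
    C * (expR (- k%:R) * k.+1%:R ^+ d).
  rewrite (eq_bigr (fun ij => expR (lam - k%:R) * (if e ij <= k.+1%:R then w ij else 0))); last first.
    by move=> ij _; case: ifP => _; rewrite ?mulr1 ?mulr0// mulrC.
  rewrite -mulr_sumr -big_mkcond /=.
  have k1 : 1 <= k.+1%:R :> R by rewrite ler1n.
  apply: le_trans (ler_wpM2l (expR_ge0 _) (wt _ k1)) _.
  rewrite sqrtrM// exprMn sqrt_eps expRD expRN.
  have -> : expR lam * expR (- k%:R) * (C * (Num.sqrt k.+1%:R ^+ d * (expR lam)^-1)) =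
      C * (expR (- k%:R) * Num.sqrt k.+1%:R ^+ d).
    by field; rewrite gt_eqF// expR_gt0.
  rewrite ler_pM2l// ler_wpM2l ?expR_ge0// lerXn2r ?nnegrE//.
  rewrite -[leRHS](sqr_sqrtr (ler0n R k.+1)) expr2 ler_peMl//.
  by rewrite -[leLHS]sqrtr1 ler_wsqrtr// ler1n.
have := bound xlnx (fun t => expR (t - 1)) measurable_xlnx xlnx_young lam lam0.
apply: le_trans; rewrite lee_fin.
have [N lamN] : exists N : nat, lam <= N%:R.
  exists (Num.truncn lam).+1; apply: ltW; have /andP[] := truncn_itv lam0; by [].
have : \sum_ij w ij * expR (Num.max 0 (lam - e ij) - 1) <= 1 + C * B.
  apply: (@le_trans _ _ (\sum_ij w ij * (1 + \sum_(k < N)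
       expR (lam - k%:R) * (e ij <= k.+1%:R)%R%:R))).
    by apply: ler_sum => ij _; rewrite ler_wpM2l// expR_layers.
  under eq_bigr do rewrite mulrDr mulr1 mulr_sumr.
  rewrite big_split /= w1 lerD2l exchange_big /=.
  apply: le_trans (ler_sum _ (fun (k : 'I_N) _ => layers k)) _.
  by rewrite -mulr_sumr ler_wpM2l ?(ltW C0)// sum_expRN_exp_le.
move=> /(ler_wpM2l (ltW eps0)).
have -> : d%:R / 2 * eps * ln eps^-1 = eps * lam by rewrite /lam; ring.
lra.
Unshelve. all: by end_near.
Qed.

(** The conjugate is at most lam^(r+1) where [e] is at most [lam], and this single sublevel set has
    mass at most lam^(-r) / 2. Half of [lam] survives, hence the constant [a / 2]. *)
Lemma power_gap_lower_bound (rho : R) : 1 < rho ->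
  exists2 K : R, 0 < K & ge_upto_bigO (gap (power_div rho))
    (fun eps => K * eps `^ (((rho - 1) * d%:R / 2 + 1)^-1)).
Proof.
move=> rho1; have dR : 0 < d%:R :> R by rewrite ltr0n.
have rho10 : 0 < rho - 1 by lra.
pose D : R := (rho - 1) * d%:R / 2 + 1; pose E : R := D^-1.
have D1 : 1 < D by rewrite /D ltrDr !mulr_gt0.
have D0 : 0 < D by lra.
have E1 : E < 1 by rewrite /E invf_lt1.
pose r : R := (rho - 1)^-1; have r0 : 0 < r by rewrite invr_gt0.
(* In [small], [a] enters through the d-th power of its square root [sa]; that power is at most [sa]
   because d >= 1, and [C * sa] is at most 1/2. *)
pose sa : R := (2 * C + 1)^-1; pose a : R := sa ^+ 2.
have C21 : 0 < 2 * C + 1 by rewrite ltr_wpDl// mulr_ge0// ltW.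
have sa0 : 0 < sa by rewrite invr_gt0.
have sa1 : sa <= 1 by rewrite /sa invf_le1// lerDr mulr_ge0// ltW.
have a0 : 0 < a by rewrite exprn_gt0.
have a1 : a <= 1 by rewrite exprn_ile1// ltW.
have sqa : Num.sqrt a = sa by rewrite sqrtr_sqr gtr0_norm.
exists (a / 2); first by rewrite divr_gt0.
exists (1 + rho^-1); near=> eps.
have eps0 : 0 < eps by [].
(* Ensures [lam >= 1], the range in which the sublevel estimate holds. *)
have epsa : eps `^ (1 - E) <= a.
  have -> : a = (a `^ (1 - E)^-1) `^ (1 - E).
    by rewrite -powRrM mulVf ?powRr1 ?(ltW a0)// gt_eqF// subr_gt0.
  rewrite ge0_ler_powR ?nnegrE ?powR_ge0 ?subr_ge0 ?(ltW E1) ?(ltW eps0)//.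
  apply: ltW; near: eps; apply: nbhs_right_lt; exact: powR_gt0.
have [n [m [e [w [e0 w0 w1 wt bound]]]]] := gapP eps0.
pose lam : R := a * eps `^ (E - 1).
have lam1 : 1 <= lam.
  rewrite /lam -opprB powRN -ler_pdivrMr ?invr_gt0 ?powR_gt0// div1r invrK//.
have lam0 : 0 <= lam by lra.
have eps_lam : eps * lam = a * eps `^ E.
  rewrite /lam mulrCA; congr (_ * _).
  by rewrite -{1}[eps]powRr1 ?ltW// -powRD ?(gt_eqF eps0) ?implybT// addrC subrK.
have small : C * lam `^ r * Num.sqrt (lam * eps) ^+ d <= 2^-1.
  rewrite [lam * eps]mulrC eps_lam sqrtrM ?(ltW a0)// sqa exprMn.
  have -> : Num.sqrt (eps `^ E) ^+ d = eps `^ (E / 2 * d%:R).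
    by rewrite -powR12_sqrt ?powR_ge0// -powRrM -powR_mulrn ?powR_ge0// -powRrM.
  rewrite /lam powRM ?powR_ge0 ?(ltW a0)// -powRrM.
  have -> : C * (a `^ r * eps `^ ((E - 1) * r)) * (sa ^+ d * eps `^ (E / 2 * d%:R)) =
      (C * (a `^ r * sa ^+ d)) * (eps `^ ((E - 1) * r) * eps `^ (E / 2 * d%:R)) by ring.
  rewrite -powRD ?(gt_eqF eps0) ?implybT//.
  (* The powers of [eps] cancel exactly because [E] is the inverse of [D]; this equation determines
     the exponent of the rate. *)
  have -> : (E - 1) * r + E / 2 * d%:R = 0.
    have -> : d%:R = 2 * (D - 1) * r by rewrite /D /r; field; rewrite gt_eqF.
    have cancel_D (x : R) : x != 0 -> (x^-1 - 1) * r + x^-1 / 2 * (2 * (x - 1) * r) = 0.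
      by move=> x0; field.
    by rewrite cancel_D// gt_eqF.
  rewrite powRr0 mulr1 (@le_trans _ _ (C * sa))//.
    rewrite ler_pM2l// -[leRHS]mul1r ler_pM ?powR_ge0 ?exprn_ge0 ?(ltW sa0)//.
      have p1 : 1 `^ r = 1 :> R by rewrite powR1.
      by rewrite -[leRHS]p1 ge0_ler_powR ?nnegrE ?(ltW r0) ?(ltW a0).
    by rewrite -[leRHS]expr1 ler_wiXn2l// ltW.
  by rewrite /sa ler_pdivrMr; lra.
have := bound (power_div rho) (fun t => t `^ (r + 1) / (r + 1) + rho^-1)
  (measurable_power_div rho) (fun x t => @power_div_young R rho x t rho1) lam lam0.
apply: le_trans; rewrite lee_fin.
have rD : lam `^ (r + 1) = lam `^ r * lam.
  by rewrite powRD ?powRr1// (gt_eqF (lt_le_trans ltr01 lam1)) implybT.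
have : \sum_ij w ij * (Num.max 0 (lam - e ij) `^ (r + 1) / (r + 1) + rho^-1) <= lam / 2 + rho^-1.
  under eq_bigr do rewrite mulrDr.
  rewrite big_split /= -mulr_suml w1 mul1r lerD2r.
  apply: (@le_trans _ _ (\sum_ij (if e ij <= lam then w ij else 0) * lam `^ (r + 1))).
    apply: ler_sum => ij _; have [elam|elam] := leP (e ij) lam; last first.
      by rewrite max_l ?powR0 ?mul0r ?mulr0//; [rewrite gt_eqF//; lra|lra].
    rewrite max_r ?subr_ge0// ler_wpM2l// ler_pdivrMr; last by lra.
    rewrite (@le_trans _ _ (lam `^ (r + 1)))//.
      by rewrite ge0_ler_powR ?nnegrE ?subr_ge0//; [lra|have := e0 ij; lra].
    by rewrite ler_peMr ?powR_ge0//; lra.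
  rewrite -mulr_suml -big_mkcond /= rD mulrA.
  have := ler_wpM2r (powR_ge0 lam r) (wt lam lam1).
  move=> h; have : (\sum_(ij | e ij <= lam) w ij) * lam `^ r <= 2^-1.
    by apply: le_trans h _; rewrite mulrAC.
  by move=> /(ler_wpM2r lam0)/le_trans; apply; lra.
move=> /(ler_wpM2l (ltW eps0)); rewrite -/D -/E.
have : a / 2 * eps `^ E = eps * lam / 2 by rewrite eps_lam; ring.
move=> ->; lra.
Unshelve. all: by end_near.
Qed.

End rates.

(** * The two lower bounds and their comparison with the upper bounds *)

Theorem proposition4p4 (R : realType) (d : nat) (X1 X2 : set 'rV[R]_d)
  (mu1 mu2 : probability 'rV[R]_d R) (c : 'rV[R]_d * 'rV[R]_d -> R)
  (d_gt0 : (0 < d)%N)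
  (X1_convex : convex_set (X1 : set (convex_lmodType 'rV[R]_d)))
  (X1_compact : compact X1)
  (X2_convex : convex_set (X2 : set (convex_lmodType 'rV[R]_d)))
  (X2_compact : compact X2)
  (mu1_X1 : mu1 X1 = 1%E) (mu2_X2 : mu2 X2 = 1%E)
  (mu1_density : bounded_density mu1) (mu2_density : bounded_density mu2)
  (c_C2 : C2_near (X1 `*` X2) c)
  (c_nondegenerate : nondegenerate_cost (X1 `*` X2) c) :
  (ge_upto_bigO
     (fun eps => OT_div xlnx eps (X1 `*` X2) c mu1 mu2
                 - OT (X1 `*` X2) c mu1 mu2)%E
     (fun eps => d%:R / 2 * eps * ln (eps^-1)) /\
   forall eps : R,
     d%:R / 2 * eps * ln (eps^-1) = entropic_upper_term (d%:R^-1) eps)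
  /\
  (forall rho : R, 1 < rho ->
     (exists2 K : R, 0 < K &
        ge_upto_bigO
          (fun eps => OT_div (power_div rho) eps (X1 `*` X2) c mu1 mu2
                      - OT (X1 `*` X2) c mu1 mu2)%E
          (fun eps => K * eps `^ (((rho - 1) * d%:R / 2 + 1)^-1))) /\
     ((rho - 1) * d%:R / 2 + 1)^-1 = power_upper_exponent rho (d%:R^-1)).
Proof.
have dR : 0 < d%:R :> R by rewrite ltr0n.
have beta : (2 * (d%:R : R)^-1)^-1 = d%:R / 2 by rewrite invfM invrK mulrC.
have [C C0 gap] := discretized_gap_bound X1_compact X2_compact mu1_X1 mu2_X2
  mu1_density mu2_density c_C2 c_nondegenerate.
split; last first.
  move=> rho rho1; split; last by rewrite /power_upper_exponent beta mulrA.
  exact: (power_gap_lower_bound (gap := fun f eps =>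
    OT_div f eps (X1 `*` X2) c mu1 mu2 - OT (X1 `*` X2) c mu1 mu2)%E d_gt0 C0 gap _ rho1).
split; last by move=> eps; rewrite /entropic_upper_term beta.
exact: (entropic_gap_lower_bound (gap := fun f eps =>
  OT_div f eps (X1 `*` X2) c mu1 mu2 - OT (X1 `*` X2) c mu1 mu2)%E d_gt0 C0 gap).
Qed.
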